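(* Let $H:\mathcal{L}_{2e}^n\to\mathcal{L}_{2e}^n$ be a causal and bounded system, let $M=M^\top\in\mathbb{R}^{m\times m}$, and let $N:\mathcal{L}_2^n\times\mathcal{L}_2^n\to\mathcal{L}_2^m$ be a causal and bounded LTI system with frequency response $N(j\omega)\in\mathbb{C}^{m\times 2n}$. Suppose $H$ satisfies the soft incremental IQC with multipliers $(M,N)$. If there exist a symmetric matrix $\Pi\in\mathbb{R}^{2\times 2}$ and a number $\tau>0$ such that $$\begin{bmatrix} I \\ N(j\omega)\end{bmatrix}^*\begin{bmatrix}\Pi\otimes I_n & 0\\ 0 & -\tau M\end{bmatrix}\begin{bmatrix} I\\ N(j\omega)\end{bmatrix}\succeq 0$$ holds for all $\omega\in\mathbb{R}$ (where the top identity block is $2n\times 2n$), then $\mathrm{SRG}(H)\subseteq\mathcal{S}(\Pi)$, where $\mathcal{S}(\Pi)=\{z\in\mathbb{C}\mid [1;\ z]^*\,\Pi\,[1;\ z]\ge 0\}$.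
   Context: $\mathcal{L}_2^n$ is the space of square-integrable signals $u:[0,\infty)\to\mathbb{R}^n$ with inner product $\langle u,y\rangle=\int_0^\infty u(t)^\top y(t)\,dt$ and norm $\|u\|=\sqrt{\langle u,u\rangle}$; $\mathcal{L}_{2e}^n$ is the set of signals $u$ whose truncations $u_T$ ($u_T(t)=u(t)$ for $t\le T$, $0$ for $t>T$) lie in $\mathcal{L}_2^n$ for all $T\ge0$. A system is an operator $H:\mathcal{L}_{2e}^n\to\mathcal{L}_{2e}^n$ with $H0=0$; it is causal if $\Gamma_T H u=\Gamma_T H \Gamma_T u$ for all $T\ge 0$, $u$ (with $\Gamma_T u=u_T$), and bounded if its incremental gain $\sup\{\|Hu-Hv\|/\|u-v\| : u,v\in\mathcal{L}_2^n,\ u\ne v\}$ is finite. The graph is $G(H)=\{(u,y)\in\mathcal{L}_2^n\times\mathcal{L}_2^n\mid y=Hu\}$. For $u,y\in\mathcal{L}_2^n$, the gain $\rho(u,y)$ is $\|y\|/\|u\|$ if $u\neq0$, $0$ if $u=y=0$, $\infty$ if $u=0\ne y$; the phase $\theta(u,y)=\arccos\frac{\langle u,y\rangle}{\|u\|\|y\|}$ if $u,y\ne0$, and $0$ otherwise. The soft scaled relative graph is $\mathrm{SRG}(H)=\{\rho(\Delta u,\Delta y)e^{\pm j\theta(\Delta u,\Delta y)} \mid (u_1,y_1),(u_2,y_2)\in G(H),\ \Delta u\ne 0\}$ with $\Delta u=u_1-u_2$, $\Delta y=y_1-y_2$. $H$ satisfies the soft incremental IQC with multipliers $(M,N)$ if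 $\int_0^\infty (N[\Delta u;\Delta y])^\top(t)\,M\,(N[\Delta u;\Delta y])(t)\,dt\ge 0$ for all $(u_1,y_1),(u_2,y_2)\in G(H)$. *)

(* Defs.v *)
From HB Require Import structures.
From mathcomp Require Import all_boot all_order all_algebra.
From mathcomp Require Import all_classical all_reals all_analysis.
From mathcomp Require Import complex.
Set Implicit Arguments. Unset Strict Implicit. Unset Printing Implicit Defensive.
Import Order.TTheory GRing.Theory Num.Theory.
Local Open Scope classical_set_scope.
Local Open Scope ring_scope.

Section SoftSRG.
Variable R : realType.
Local Notation mu := (@lebesgue_measure R).
Local Notation C := (R[i]).

(* Signals u : [0,oo) -> R^p, represented as functions R -> 'rV_p;
   only the values on [0,+oo[ matter. *)
Definition sig (p : nat) := R -> 'rV[R]_p.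

Definition Rplus : set R := `[0, +oo[%classic.

Definition sqn p (x : 'rV[R]_p) : R := \sum_i x 0 i ^+ 2.
Definition dotv p (x y : 'rV[R]_p) : R := \sum_i x 0 i * y 0 i.

Definition sig_sub p (u v : sig p) : sig p := fun t => u t - v t.

Definition inL2 p (u : sig p) : Prop :=
  (forall i, measurable_fun Rplus (fun t => u t 0 i)) /\
  (\int[mu]_(t in Rplus) (sqn (u t))%:E < +oo)%E.

Definition trunc p (T : R) (u : sig p) : sig p :=
  fun t => if t <= T then u t else 0.

Definition inL2e p (u : sig p) : Prop := forall T, 0 <= T -> inL2 (trunc T u).

Definition ip p (u y : sig p) : R := \int[mu]_(t in Rplus) dotv (u t) (y t).
Definition nrm p (u : sig p) : R := Num.sqrt (\int[mu]_(t in Rplus) sqn (u t)).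

Definition aeeq p (u v : sig p) : Prop := {ae mu, forall t, Rplus t -> u t = v t}.

Definition zsig p : sig p := fun _ => 0.

Definition is_system n (H : sig n -> sig n) : Prop :=
  (forall u, inL2e u -> inL2e (H u)) /\ aeeq (H (zsig n)) (zsig n).

Definition causal_on p q (D : sig p -> Prop) (F : sig p -> sig q) : Prop :=
  forall u, D u -> forall T, 0 <= T -> aeeq (trunc T (F u)) (trunc T (F (trunc T u))).

Definition bounded p q (F : sig p -> sig q) : Prop :=
  exists g : R, forall u v, inL2 u -> inL2 v -> nrm (sig_sub u v) != 0 ->
    inL2 (sig_sub (F u) (F v)) /\
    nrm (sig_sub (F u) (F v)) <= g * nrm (sig_sub u v).

Definition shift p (s : R) (u : sig p) : sig p :=
  fun t => if s <= t then u (t - s) else 0.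

Definition linear_sys p q (F : sig p -> sig q) : Prop :=
  forall (a b : R) u v, inL2 u -> inL2 v ->
    aeeq (F (fun t => a *: u t + b *: v t)) (fun t => a *: F u t + b *: F v t).

Definition time_invariant p q (F : sig p -> sig q) : Prop :=
  forall s u, 0 <= s -> inL2 u -> aeeq (F (shift s u)) (shift s (F u)).

Definition toC (x : R) : C := Complex x 0.

(* \int_0^T z(t) e^{-j w t} dt, componentwise *)
Definition ftT p (T : R) (z : sig p) (w : R) : 'rV[C]_p :=
  \row_i Complex (\int[mu]_(t in `[0, T]) (z t 0 i * cos (w * t)))
                 (- \int[mu]_(t in `[0, T]) (z t 0 i * sin (w * t))).

Definition sqnC p (x : 'rV[C]_p) : R :=
  \sum_i (complex.Re (x 0 i) ^+ 2 + complex.Im (x 0 i) ^+ 2).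

(* F is the (L_2) Fourier transform of z: F = l.i.m._{T -> oo} of the
   truncated transforms, in L_2(R; C^p) *)
Definition isFT p (z : sig p) (F : R -> 'rV[C]_p) : Prop :=
  (forall i, measurable_fun setT (fun w => complex.Re (F w 0 i)) /\
             measurable_fun setT (fun w => complex.Im (F w 0 i))) /\
  ((\int[mu]_(w in setT) (sqnC (F w - ftT T z w))%:E)%E @[T --> +oo] --> 0%E).

(* N has frequency response Nhat : multiplication by Nhat(jw) in the frequency
   domain (signals are rows, so y^ = Nhat u^ reads as y^T = u^T Nhat^T) *)
Definition freq_resp p q (F : sig p -> sig q) (Nhat : R -> 'M[C]_(q, p)) : Prop :=
  forall z Z, inL2 z -> isFT z Z -> isFT (F z) (fun w => Z w *m (Nhat w)^T).

Definition LTI_freq p q (F : sig p -> sig q) (Nhat : R -> 'M[C]_(q, p)) : Prop :=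
  (forall z, inL2 z -> inL2 (F z)) /\
  linear_sys F /\ time_invariant F /\
  causal_on (@inL2 p) F /\ bounded F /\ freq_resp F Nhat.

Definition stack n (u y : sig n) : sig (n + n) := fun t => row_mx (u t) (y t).

Definition soft_iqc n m (H : sig n -> sig n) (M : 'M[R]_m) (N : sig (n + n) -> sig m) :
  Prop :=
  forall u1 u2, inL2 u1 -> inL2 (H u1) -> inL2 u2 -> inL2 (H u2) ->
    (0 <= \int[mu]_(t in Rplus)
       (let q := N (stack (sig_sub u1 u2) (sig_sub (H u1) (H u2))) t in
        (q *m M *m q^T) 0 0)%:E)%E.

Definition gain p (u y : sig p) : R := nrm y / nrm u.  (* used only when u <> 0 *)

Definition phase p (u y : sig p) : R :=
  if (nrm u != 0) && (nrm y != 0) then acos (ip u y / (nrm u * nrm y)) else 0.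

Definition SRG n (H : sig n -> sig n) : set C :=
  [set z | exists u1 u2, [/\ inL2 u1, inL2 (H u1), inL2 u2, inL2 (H u2) &
     let du := sig_sub u1 u2 in let dy := sig_sub (H u1) (H u2) in
     nrm du != 0 /\
     (z = Complex (gain du dy * cos (phase du dy)) (gain du dy * sin (phase du dy)) \/
      z = Complex (gain du dy * cos (phase du dy)) (- (gain du dy * sin (phase du dy))))]].

Definition ctr a b (A : 'M[C]_(a, b)) : 'M[C]_(b, a) := (map_mx (@conjc R) A)^T.

(* Hermitian positive semidefinite (order on C: real and >= 0) *)
Definition psdC k (A : 'M[C]_k) : Prop := forall v : 'cV[C]_k, 0 <= (ctr v *m A *m v) 0 0.

(* Pi (x) I_n, written out blockwise (indices of R^{2n} = R^{n+n}) *)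
Definition kronI n (P : 'M[R]_2) : 'M[R]_(n + n) :=
  block_mx (P 0 0)%:M (P 0 1)%:M (P 1 0)%:M (P 1 1)%:M.

Definition SPi (P : 'M[R]_2) : set C :=
  [set z | let v : 'cV[C]_2 := \col_(i < 2) (if i == 0 then 1 else z) in
           0 <= (ctr v *m map_mx toC P *m v) 0 0].

End SoftSRG.

(* Main.v *)
(* Integrating the frequency-domain inequality along the Fourier transform of
   z = (du, dy) and applying Parseval on both sides gives
   int z^T (Pi (x) I) z >= tau int (N z)^T M (N z) >= 0, and the left-hand side
   is |du|^2 times the quadratic form defining S(Pi) at rho e^(+-j theta).

   Plancherel for signals supported in [0, T] is obtained by Abel summation:
   int_0^oo e^(-e w) |f^(w)|^2 dw is the double integral of f(s) f(t) against
   the Poisson kernel e / (e^2 + (s - t)^2).  AM-GM and int poisson <= pi bound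
   it by pi |f|^2; for bounded continuous f it converges to pi |f|^2 as e -> 0;
   density of these functions in L_2 concludes.  The L_2 transform of a signal
   on [0, oo) then exists by a Riesz-Fischer argument. *)
Require Import Defs.
From HB Require Import structures.
From mathcomp Require Import all_boot all_order all_algebra.
From mathcomp Require Import all_classical all_reals all_analysis.
From mathcomp Require Import complex.
From mathcomp Require Import measurable_realfun ring lra.
Set Implicit Arguments.
Unset Strict Implicit.
Unset Printing Implicit Defensive.
Import Order.TTheory GRing.Theory Num.Theory.
Import numFieldNormedType.Exports.
Local Open Scope classical_set_scope.
Local Open Scope ring_scope.

(** * Poisson kernel *)

Section poisson_kernel.
Context {R : realType}.
Local Notation mu := (@lebesgue_measure R).
Implicit Types (e x w d s t a b T : R).

(** The hypothesis [freq_resp] gives nothing about [z] until some transform of [z] in the sense of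
    [isFT] is supplied; this is why existence of the L_2 transform has to be proved, and not only
    its isometry. A transform of [N z] then comes from the hypothesis itself. The obstacle to
    Plancherel is that the squared modulus of the transform is not known to be integrable, so the
    integrals cannot be exchanged directly. The factor e^(-e w) makes the exchange legitimate, and
    monotone convergence removes it even if the limit were infinite. Bessel's inequality comes
    before the equality because the density argument needs it: it controls the transform of the
    error f - g for an arbitrary square-integrable f. Triangle inequalities in L_2 are replaced by
    x^2 <= (1 + eta) y^2 + (1 + 1/eta) (x - y)^2, integrated, with an error of size eta^2 and eta ->
    0. Transforms are carried as pairs of real cosine and sine integrals; complex numbers return
    only for vector signals and matrices. *)

Definition poisson e x : R := e / (e ^+ 2 + x ^+ 2).

Let den_gt0 e x : 0 < e -> 0 < e ^+ 2 + x ^+ 2.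
Proof. by move=> e0; rewrite ltr_pwDl ?exprn_gt0 ?sqr_ge0. Qed.

Lemma poisson_ge0 e x : 0 < e -> 0 <= poisson e x.
Proof. by move=> e0; rewrite divr_ge0 ?ltW// den_gt0. Qed.

Lemma poisson_le e x : 0 < e -> poisson e x <= e^-1.
Proof.
move=> e0; rewrite /poisson ler_pdivrMr ?den_gt0// mulrDr expr2 mulrA.
by rewrite mulVf ?gt_eqF// mul1r lerDl mulr_ge0 ?invr_ge0 ?sqr_ge0 ?ltW.
Qed.

Lemma poisson_tail e x d : 0 < e -> 0 < d -> d <= `|x| ->
  poisson e x <= e / d ^+ 2.
Proof.
move=> e0 d0 dx; rewrite /poisson ler_pM2l// lef_pV2 ?posrE ?exprn_gt0 ?den_gt0//.
rewrite -(real_normK (num_real x)); apply: (@le_trans _ _ (`|x| ^+ 2)).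
  by rewrite lerXn2r ?nnegrE ?(ltW d0).
by rewrite lerDr exprn_ge0// ltW.
Qed.

Lemma continuous_poisson e : 0 < e -> continuous (poisson e).
Proof.
move=> e0 x; apply: cvgM; first exact: cvg_cst.
apply: cvgV; first by rewrite gt_eqF ?den_gt0.
by apply: cvgD; [exact: cvg_cst | exact: exprn_continuous].
Qed.

Lemma is_derive_atan_poisson e s t : 0 < e ->
  is_derive t 1 (fun t : R => atan ((t - s) / e)) (poisson e (s - t)).
Proof.
move=> e0.
have h : is_derive t 1 (fun t : R => (t - s) / e) (e^-1).
  by apply: is_derive_eq; rewrite !scaler0 ?add0r ?subr0 /GRing.scale/= ?mulr1.
have := @is_derive1_comp _ _ (fun t => (t - s) / e) _ _ _ (is_derive1_atan _) h.
move=> /(@is_derive_eq _ _ _ _ _ _ _); apply.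
rewrite /poisson /GRing.scale/=; field.
by rewrite !gt_eqF//= ?den_gt0 // ltr_pwDl ?exprn_gt0 ?sqr_ge0.
Qed.

Lemma is_derive_continuous (F f : R -> R) :
  (forall x, is_derive x 1 F (f x)) -> continuous F.
Proof.
move=> dF x; apply: differentiable_continuous; apply/derivable1_diffP.
exact: ex_derive.
Qed.

Lemma continuous_Rint_FTC (f F : R -> R) a b : a <= b -> continuous f ->
  (forall x, is_derive x 1 F (f x)) ->
  \int[mu]_(x in `[a, b]) f x = F b - F a.
Proof.
rewrite le_eqVlt => /predU1P[<-|ab] cf dF.
  by rewrite subrr set_itv1 Rintegral_set1.
have cF := is_derive_continuous dF.
rewrite /Rintegral (@continuous_FTC2 _ _ F)//.
- exact: continuous_subspaceT.
- split; first by move=> x _; exact: ex_derive.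
  + exact/cvg_at_right_filter/cF.
  + exact/cvg_at_left_filter/cF.
- by move=> x _; rewrite derive1E; exact: derive_val.
Qed.

(** The antiderivative is an arctangent, so the mass is exact: it stays below pi, and as e -> 0 it
    tends to pi for s inside ]0, T[ but only to pi / 2 at the endpoints when T > 0. The factors pi
    in the estimates below come from here. *)
Lemma Rintegral_poisson e s T : 0 < e -> 0 <= T ->
  \int[mu]_(t in `[0, T]) poisson e (s - t) = atan ((T - s) / e) + atan (s / e).
Proof.
move=> e0 T0.
have cp : continuous (fun t => poisson e (s - t)).
  move=> t; apply: (@continuous_comp _ _ _ (fun t => s - t)).
    by apply: cvgB; [exact: cvg_cst | exact: cvg_id].
  exact: continuous_poisson.
rewrite (continuous_Rint_FTC T0 cp (fun t => is_derive_atan_poisson s t e0)).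
by rewrite sub0r mulNr atanN opprK.
Qed.

Lemma Rintegral_poisson_le e s T : 0 < e -> 0 <= T ->
  \int[mu]_(t in `[0, T]) poisson e (s - t) <= pi.
Proof.
move=> e0 T0; rewrite Rintegral_poisson//.
by rewrite [leRHS](splitr pi) lerD// ltW// atan_ltpi2.
Qed.

Lemma laplace_expR e : 0 < e ->
  mu.-integrable `[0, +oo[ (EFin \o (fun w => expR (- e * w))) /\
  \int[mu]_(w in `[0, +oo[) expR (- e * w) = e^-1.
Proof.
move=> e0.
have cf : continuous (fun w => expR (- e * w)).
  move=> w; apply: (@continuous_comp _ _ _ (fun w => - e * w)).
    by apply: cvgM; [exact: cvg_cst | exact: cvg_id].
  exact: continuous_expR.
have dF w : is_derive w 1 (fun w => - e^-1 * expR (- e * w)) (expR (- e * w)).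
  apply: is_derive_eq; rewrite /GRing.scale/=.
  by rewrite ?mulr1 ?scaler0 ?addr0 ?mul0r ?add0r; field; rewrite gt_eqF.
have cF := is_derive_continuous dF.
have I : (\int[mu]_(w in `[0%R, +oo[) (expR (- e * w))%:E = (e^-1)%:E)%E.
  rewrite (@ge0_continuous_FTC2y _ _ (fun w => - e^-1 * expR (- e * w)) _ 0)//.
  - by rewrite mulr0 expR0 mulr1 EFinN oppeK add0e.
  - exact: continuous_subspaceT.
  - rewrite -[X in _ --> X](mulr0 (- e^-1)); apply: cvgMr.
    rewrite (_ : (fun x => expR (- e * x)) =
               (fun z => expR (- z)) \o (fun z => e * z)); last first.
      by apply: eq_fun => x; rewrite mulNr.
    apply: (@cvg_comp _ _ _ _ _ _ (pinfty_nbhs R)); last exact: cvgr_expR.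
    exact: gt0_cvgMry.
  - exact/cvg_at_right_filter/cF.
  - by move=> x _; rewrite derive1E; exact: derive_val.
split; last by rewrite /Rintegral I.
apply/integrableP; split.
  by apply/measurable_EFinP/measurable_funTS; exact: continuous_measurable_fun.
under eq_integral do rewrite /= ger0_norm ?expR_ge0//.
by rewrite I ltry.
Qed.

(** The fundamental theorem on an unbounded interval is applied to a nonnegative integrand, so 1 +
    cos replaces cos, and the integral 1/e of the exponential is subtracted at the end. *)
Lemma Rintegral_expR_cos e x : 0 < e ->
  \int[mu]_(w in `[0, +oo[) (expR (- e * w) * cos (w * x)) = poisson e x.
Proof.
move=> e0; have [iE IE] := laplace_expR e0.
have cE : continuous (fun w => expR (- e * w)).
  move=> w; apply: (@continuous_comp _ _ _ (fun w => - e * w)).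
    by apply: cvgM; [exact: cvg_cst | exact: cvg_id].
  exact: continuous_expR.
have cc : continuous (fun w => cos (w * x)).
  move=> w; apply: (@continuous_comp _ _ _ (fun w => w * x)).
    by apply: cvgM; [exact: cvg_id | exact: cvg_cst].
  exact: continuous_cos.
(* Antiderivative of e^(-e w) (1 + cos (w x)); the fraction is what two integrations by parts give
   for the cosine part. *)
pose F w := - e^-1 * expR (- e * w) +
  expR (- e * w) * ((x * sin (w * x) - e * cos (w * x)) / (e ^+ 2 + x ^+ 2)).
have dF w : is_derive w 1 F (expR (- e * w) * (1 + cos (w * x))).
  apply: is_derive_eq; rewrite /GRing.scale/=.
  rewrite ?mulr1 ?scaler0 ?addr0 ?mul0r ?add0r ?mulr0 ?addr0.
  by field; rewrite !gt_eqF ?den_gt0.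
have cF := is_derive_continuous dF.
have iC : mu.-integrable `[0, +oo[ (EFin \o (fun w => expR (- e * w) * cos (w * x))).
  apply: (le_integrable _ _ _ iE) => //.
    apply/measurable_EFinP/measurable_funTS.
    by apply: measurable_funM; exact: continuous_measurable_fun.
  move=> w _ /=; rewrite lee_fin normrM ler_piMr//.
  by rewrite ler_norml cos_geN1 cos_le1.
have cEx : expR (- e * w) @[w --> +oo] --> 0.
  rewrite (_ : (fun x => expR (- e * x)) =
               (fun z => expR (- z)) \o (fun z => e * z)); last first.
    by apply: eq_fun => z; rewrite mulNr.
  apply: (@cvg_comp _ _ _ _ _ _ (pinfty_nbhs R)); last exact: cvgr_expR.
  exact: gt0_cvgMry.
have f0 w : 0 <= expR (- e * w) * (1 + cos (w * x)).
  by rewrite mulr_ge0 ?expR_ge0// -lerBlDl sub0r cos_geN1.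
have : \int[mu]_(w in `[0, +oo[) (expR (- e * w) * (1 + cos (w * x))) = 0 - F 0.
  apply: (Rintegral_ge0_continuous_FTC2y (fun w _ => f0 w)) => //.
  - apply: continuous_subspaceT => w; apply: cvgM; first exact: cE.
    by apply: cvgD; [exact: cvg_cst | exact: cc].
  - rewrite -[X in _ --> X](addr0 0); apply: cvgD.
      by rewrite -[X in _ --> X](mulr0 (- e^-1)); apply: cvgMr.
    apply/cvgr0Pnorm_lt => d d0.
    (* [K] bounds the trigonometric fraction in [F], so that term vanishes at infinity with the
       exponential. *)
    pose K := (`|x| + e) / (e ^+ 2 + x ^+ 2).
    have K0 : 0 <= K by apply: divr_ge0; [rewrite addr_ge0 ?(ltW e0) | exact/ltW/den_gt0].
    have dK : 0 < d / (K + 1) by rewrite divr_gt0// ltr_wpDl.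
    move/cvgr0Pnorm_lt : cEx => /(_ _ dK); apply: filterS => w.
    rewrite ltr_pdivlMr ?ltr_wpDl// => /(le_lt_trans _); apply.
    rewrite normrM ler_wpM2l//.
    apply: (@le_trans _ _ K); last by rewrite lerDl.
    rewrite normrM normfV (gtr0_norm (den_gt0 _ e0)) ler_pM2r ?invr_gt0 ?den_gt0//.
    rewrite (le_trans (ler_normB _ _))// !normrM (gtr0_norm e0).
    apply: lerD; apply: ler_piMr => //; rewrite ?(ltW e0)// ler_norml.
      by rewrite sin_geN1 sin_le1.
    by rewrite cos_geN1 cos_le1.
  - exact/cvg_at_right_filter/cF.
  - by move=> w _; rewrite derive1E; exact: derive_val.
under eq_Rintegral do rewrite mulrDr mulr1.
rewrite RintegralD// IE /F !mulr0 !mul0r expR0 sin0 cos0.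
move=> /(canRL (addKr _)) ->; rewrite /poisson.
by field; rewrite !gt_eqF ?den_gt0.
Qed.

End poisson_kernel.

(** * Exchange of integrals *)

Section Rintegral_swap.
Context {R : realType}.
Local Notation mu := (@lebesgue_measure R).
Local Notation mR := (measurableTypeR R).

Lemma integrable_mul_bounded (D : set mR) (f g : R -> R) (K : R) :
  measurable D -> mu.-integrable D (EFin \o f) ->
  measurable_fun D g -> (forall x, D x -> `|g x| <= K) ->
  mu.-integrable D (EFin \o (fun x => f x * g x)).
Proof.
move=> mD fi mg gK.
have mf : measurable_fun D f by apply/measurable_EFinP; exact: measurable_int fi.
apply: (le_integrable mD _ _ (integrableZl mD K fi)).
- by apply/measurable_EFinP; exact: measurable_funM.
- move=> x Dx; rewrite -EFinM !abse_EFin lee_fin !normrM mulrC ler_wpM2r//.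
  exact: le_trans (gK x Dx) (ler_norm _).
Qed.

(** Fubini for integrable weights and a bounded kernel: K |p(x)| |q(y)| dominates the integrand, and
    its double integral factorises. Integrability of the outer integrand is returned as well,
    because [integrable_smooth] rests on it. *)
Lemma Rintegral_swapT (p q : R -> R) (k : R -> R -> R) (K : R) :
  mu.-integrable setT (EFin \o p) -> mu.-integrable setT (EFin \o q) ->
  measurable_fun [set: mR * mR] (fun z => k z.1 z.2) ->
  (forall x y, `|k x y| <= K) ->
  mu.-integrable setT (EFin \o (fun x => p x * \int[mu]_y (q y * k x y))) /\
  \int[mu]_x (p x * \int[mu]_y (q y * k x y)) =
    \int[mu]_y (q y * \int[mu]_x (p x * k x y)).
Proof.
move=> ip iq mk kK.
have mp : measurable_fun [set: mR] p.
  by apply/measurable_EFinP; exact: measurable_int ip.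
have mq : measurable_fun [set: mR] q.
  by apply/measurable_EFinP; exact: measurable_int iq.
have K0 : 0 <= K by exact: le_trans (kK 0 0).
pose h (z : mR * mR) : R := p z.1 * q z.2 * k z.1 z.2.
have mh : measurable_fun setT h.
  apply: measurable_funM => //; apply: measurable_funM.
    by apply: measurableT_comp => //; exact: measurable_fst.
  by apply: measurableT_comp => //; exact: measurable_snd.
have mkx x : measurable_fun [set: mR] (k x).
  exact: (measurableT_comp mk (measurable_pair1 x)).
have mky y : measurable_fun [set: mR] (k^~ y).
  exact: (measurableT_comp mk (measurable_pair2 y)).
have iqk x : mu.-integrable setT (EFin \o (fun y => q y * k x y)).
  exact: (@integrable_mul_bounded _ _ _ K).
have ipk y : mu.-integrable setT (EFin \o (fun x => p x * k x y)).
  exact: (@integrable_mul_bounded _ _ _ K).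
have ih : (mu \x mu)%E.-integrable setT (EFin \o h).
  apply/integrable12ltyP; first exact/measurable_EFinP.
  apply: (@le_lt_trans _ _ (\int[mu]_x \int[mu]_y
      ((K * `|p x|)%:E * `|q y|%:E))%E).
    apply: ge0_le_integral => //.
    - by move=> x _; apply: integral_ge0.
    - apply: (measurable_fun_fubini_tonelli_F (fun z => `|(h z)%:E|%E)) => //.
      by apply: measurableT_comp => //; exact/measurable_EFinP.
    - apply: (measurable_fun_fubini_tonelli_F
          (fun z : mR * mR => ((K * `|p z.1|)%:E * `|q z.2|%:E)%E)) => //; last first.
        by move=> z; rewrite mule_ge0// lee_fin// mulr_ge0.
      apply/measurable_EFinP; apply: measurable_funM.
        apply: measurable_funM => //; apply: measurableT_comp => //.
        by apply: measurableT_comp => //; exact: measurable_fst.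
      apply: measurableT_comp => //.
      by apply: measurableT_comp => //; exact: measurable_snd.
    - move=> x _; apply: ge0_le_integral => //.
      + apply: measurableT_comp => //; apply/measurable_EFinP.
        by exact: (measurableT_comp mh (measurable_pair1 x)).
      + apply/measurable_EFinP; apply: measurable_funM => //.
        exact: measurableT_comp.
      + move=> y _; rewrite /h/= lee_fin !normrM mulrC mulrA.
        by rewrite ler_wpM2r// ler_wpM2r.
  under eq_integral => x _.
    rewrite ge0_integralZl//; last 2 first.
    - by apply/measurable_EFinP; exact: measurableT_comp.
    - by rewrite lee_fin mulr_ge0.
    over.
  move/integrableP : iq => [_ iq].
  have iq' : (\int[mu]_y `|q y|%:E \is a fin_num)%E.
    by rewrite ge0_fin_numE ?integral_ge0.
  move/integrableP : ip => [_ ip].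
  have ip' : (\int[mu]_x `|p x|%:E \is a fin_num)%E.
    by rewrite ge0_fin_numE ?integral_ge0.
  rewrite -(fineK iq').
  under eq_integral do rewrite -EFinM mulrAC EFinM.
  rewrite ge0_integralZl//; last 2 first.
  - by apply/measurable_EFinP; exact: measurableT_comp.
  - by rewrite lee_fin mulr_ge0// fine_ge0// integral_ge0.
  by rewrite -(fineK ip') -EFinM ltry.
(* Both outer integrands are marginals of [h], which reduces the real-valued claim to Fubini's
   theorem in the extended reals. *)
have eF x : ((p x * \int[mu]_y (q y * k x y))%:E = \int[mu]_y (h (x, y))%:E)%E.
  rewrite /h/=.
  under [RHS]eq_integral do rewrite -mulrA EFinM.
  rewrite (integralZl measurableT (iqk x)) EFinM /Rintegral fineK//.
  apply: integrable_fin_num => //; exact: iqk.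
have eG y : ((q y * \int[mu]_x (p x * k x y))%:E = \int[mu]_x (h (x, y))%:E)%E.
  rewrite /h/=.
  under [RHS]eq_integral do rewrite (mulrC (p _)) -mulrA EFinM.
  rewrite (integralZl measurableT (ipk y)) EFinM /Rintegral fineK//.
  apply: integrable_fin_num => //; exact: ipk.
split.
- rewrite [X in integrable _ _ X](_ : _ = fubini_F mu (EFin \o h)).
    exact: integrable_fubini_F.
  by apply/funext => x; rewrite /= eF.
- rewrite /Rintegral; congr fine.
  under eq_integral do rewrite eF.
  under [RHS]eq_integral do rewrite eG.
  exact: (Fubini ih).
Qed.

(** Extension of the weights by zero reduces the case of two domains to the whole line. *)
Lemma Rintegral_swap (D I : set mR) (p q : R -> R) (k : R -> R -> R) (K : R) :
  measurable D -> measurable I ->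
  mu.-integrable D (EFin \o p) -> mu.-integrable I (EFin \o q) ->
  measurable_fun [set: mR * mR] (fun z => k z.1 z.2) ->
  (forall x y, `|k x y| <= K) ->
  mu.-integrable D (EFin \o (fun x => p x * \int[mu]_(y in I) (q y * k x y))) /\
  \int[mu]_(x in D) (p x * \int[mu]_(y in I) (q y * k x y)) =
    \int[mu]_(y in I) (q y * \int[mu]_(x in D) (p x * k x y)).
Proof.
move=> mD mI ip iq mk kK.
have ip' : mu.-integrable setT (EFin \o (p \_ D)).
  by rewrite -restrict_EFin; exact: (@integrable_mkcond _ mR R mu D (EFin \o p) mD).1 ip.
have iq' : mu.-integrable setT (EFin \o (q \_ I)).
  by rewrite -restrict_EFin; exact: (@integrable_mkcond _ mR R mu I (EFin \o q) mI).1 iq.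
have [i1 e] := Rintegral_swapT ip' iq' mk kK.
have pat (A : set mR) (f g : R -> R) x : (f \_ A) x * g x = ((fun x => f x * g x) \_ A) x.
  by rewrite !patchE; case: ifP => //; rewrite mul0r.
have e1 x : \int[mu]_y ((q \_ I) y * k x y) = \int[mu]_(y in I) (q y * k x y).
  by rewrite [RHS]Rintegral_mkcond; apply: eq_Rintegral => y _; rewrite (pat I q (k x)).
have e2 y : \int[mu]_x ((p \_ D) x * k x y) = \int[mu]_(x in D) (p x * k x y).
  by rewrite [RHS]Rintegral_mkcond; apply: eq_Rintegral => x _; rewrite (pat D p (k^~ y)).
split.
- apply/integrable_mkcond => //; rewrite restrict_EFin.
  apply: eq_integrable i1 => // x _ /=; congr EFin.
  by rewrite e1 (pat D p (fun x => \int[mu]_(y in I) (q y * k x y))).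
- rewrite [LHS]Rintegral_mkcond [RHS]Rintegral_mkcond.
  transitivity (\int[mu]_x ((p \_ D) x * \int[mu]_y ((q \_ I) y * k x y))).
    apply: eq_Rintegral => x _.
    by rewrite e1 (pat D p (fun x => \int[mu]_(y in I) (q y * k x y))).
  rewrite e; apply: eq_Rintegral => y _.
  by rewrite e2 (pat I q (fun y => \int[mu]_(x in D) (p x * k x y))).
Qed.

End Rintegral_swap.

(** * Transforms of square-integrable functions on [0, T] *)

Section truncated_transform.
Context {R : realType}.
Local Notation mu := (@lebesgue_measure R).
Local Notation mR := (measurableTypeR R).
Implicit Types (f g : R -> R) (I : set mR) (T e w s t : R).

Definition sqint I f :=
  measurable_fun I f /\ mu.-integrable I (EFin \o (fun t => f t ^+ 2)).

(** The squares of f + g and f - g are nonnegative, whence |f g| <= f^2 + g^2; the sharper factor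
    1/2 would bring nothing here. *)
Lemma integrable_sqintM I f g : measurable I -> sqint I f -> sqint I g ->
  mu.-integrable I (EFin \o (fun t => f t * g t)).
Proof.
move=> mI [mf fi] [mg gi].
apply: (le_integrable mI _ _ (integrableD mI fi gi)).
  by apply/measurable_EFinP; exact: measurable_funM.
move=> t _ /=; rewrite lee_fin [leRHS]ger0_norm ?addr_ge0 ?sqr_ge0//.
rewrite ler_norml; apply/andP; split.
  by rewrite -subr_ge0; have := sqr_ge0 (f t + g t); have := sqr_ge0 (f t);
     have := sqr_ge0 (g t); lra.
by rewrite -subr_ge0; have := sqr_ge0 (f t - g t); have := sqr_ge0 (f t);
   have := sqr_ge0 (g t); lra.
Qed.

Lemma sqintD I f g : measurable I -> sqint I f -> sqint I g ->
  sqint I (fun t => f t + g t).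
Proof.
move=> mI hf hg; have fg := integrable_sqintM mI hf hg.
case: hf hg => [mf fi] [mg gi]; split; first exact: measurable_funD.
have h := integrableD mI (integrableD mI fi gi) (integrableZl mI 2 fg).
by apply: eq_integrable h => // t _ /=; congr EFin; ring.
Qed.

Lemma sqintZ I f (a : R) : measurable I -> sqint I f ->
  sqint I (fun t => a * f t).
Proof.
move=> mI [mf fi]; split; first exact: measurable_funM.
apply: eq_integrable (integrableZl mI (a ^+ 2) fi) => // t _ /=.
by rewrite exprMn.
Qed.

Lemma sqintB I f g : measurable I -> sqint I f -> sqint I g ->
  sqint I (fun t => f t - g t).
Proof.
move=> mI hf hg; have h := sqintD mI hf (sqintZ (-1) mI hg).
by under eq_fun do rewrite -mulN1r.
Qed.

Lemma sqintS I J f : measurable I -> measurable J -> J `<=` I ->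
  sqint I f -> sqint J f.
Proof.
move=> mI mJ JI [mf fi]; split; first exact: measurable_funS mf.
exact: (integrableS mI).
Qed.

Lemma eq_sqint I f g : measurable I -> {in I, f =1 g} -> sqint I f -> sqint I g.
Proof.
move=> mI fg [mf fi]; split; first exact: eq_measurable_fun mf.
by apply: eq_integrable fi => // t tI /=; rewrite fg.
Qed.

Definition seg T : set mR := `[0, T].

Lemma measurable_seg T : measurable (seg T).
Proof. exact: measurable_itv. Qed.

Lemma seg_finite T : (mu (seg T) < +oo)%E.
Proof.
by rewrite /seg lebesgue_measure_itv/=; case: ifP => _; rewrite ltry.
Qed.

Lemma integrable_seg_cst T (c : R) : mu.-integrable (seg T) (EFin \o cst c).
Proof.
apply: measurable_bounded_integrable; [exact: measurable_seg|exact: seg_finite|..].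
  exact: measurable_cst.
by exists `|c|; split; rewrite ?num_real// => x /ltW cx t _.
Qed.

Lemma sqint_seg_cst T c : sqint (seg T) (cst c).
Proof. by split; [exact: measurable_cst | exact: (integrable_seg_cst T (c ^+ 2))]. Qed.

(** A segment has finite measure, so L_2 is contained in L_1: multiply by the constant 1. *)
Lemma integrable_sqint T f : sqint (seg T) f -> mu.-integrable (seg T) (EFin \o f).
Proof.
move=> hf; have := integrable_sqintM (measurable_seg T) hf (sqint_seg_cst T 1).
by apply: eq_integrable => [|t _ /=]; [exact: measurable_seg | rewrite mulr1].
Qed.

Definition cosT T f w := \int[mu]_(t in seg T) (f t * cos (w * t)).
Definition sinT T f w := \int[mu]_(t in seg T) (f t * sin (w * t)).
(** The squared modulus of the transform [cosT - j sinT] of [f] cut to [0, T]. *)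
Definition energy T f w := cosT T f w ^+ 2 + sinT T f w ^+ 2.

Lemma energy_ge0 T f w : 0 <= energy T f w.
Proof. by rewrite addr_ge0 ?sqr_ge0. Qed.

Lemma norm_cos_le1 (x : R) : `|cos x| <= 1.
Proof. by rewrite ler_norml cos_geN1 cos_le1. Qed.

Lemma norm_sin_le1 (x : R) : `|sin x| <= 1.
Proof. by rewrite ler_norml sin_geN1 sin_le1. Qed.

Lemma measurable_trig (k : R -> R) (c : R) (I : set mR) : continuous k ->
  measurable_fun I (fun t : R => k (c * t)).
Proof.
move=> ck; apply: measurable_funTS.
apply: (measurableT_comp (continuous_measurable_fun ck)).
exact: (measurable_funM (measurable_cst c) (@measurable_id _ mR setT)).
Qed.

Lemma integrable_trig (k : R -> R) T f (c : R) : continuous k ->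
  (forall x, `|k x| <= 1) -> sqint (seg T) f ->
  mu.-integrable (seg T) (EFin \o (fun t => f t * k (c * t))).
Proof.
move=> ck k1 hf.
apply: (@integrable_mul_bounded _ _ _ (fun t => k (c * t)) 1).
- exact: measurable_seg.
- exact: integrable_sqint.
- exact: measurable_trig.
- by [].
Qed.

Lemma continuous_transform (k : R -> R) T f : continuous k ->
  (forall x, `|k x| <= 1) -> sqint (seg T) f ->
  continuous (fun w => \int[mu]_(t in seg T) (f t * k (w * t))).
Proof.
move=> ck k1 hf w.
have iF x : mu.-integrable (seg T) (EFin \o (fun t => f t * k (x * t))).
  exact: integrable_trig.
have cF t : continuous (fun w => f t * k (w * t)).
  have ct : continuous (fun x : R => x * t).
    by move=> x; apply: cvgM; [exact: cvg_id | exact: cvg_cst].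
  move=> x; exact: (cvgM (cvg_cst _) (continuous_comp (ct x) (ck (x * t)))).
(* Continuity is local, so any window around w will do; |f| dominates uniformly in the frequency. *)
have := @continuity_under_integral R _ mR mu (fun w t => f t * k (w * t))
  (seg T) (measurable_seg T) (w - 1) (w + 1) _ _ (fun t => `|f t|) _ _ w.
apply.
- by move=> x _; exact: iF.
- by apply/aeW => t _ x _; exact: cF.
- have := integrable_norm (integrable_sqint hf); exact.
- by move=> x _; apply/aeW => t _; rewrite normrM ler_piMr.
- by rewrite inE/= in_itv/= ltrBlDr ltrDl ltr01.
Qed.

Lemma continuous_cosT T f : sqint (seg T) f -> continuous (cosT T f).
Proof. by apply: continuous_transform; [exact: continuous_cos|exact: norm_cos_le1]. Qed.

Lemma continuous_sinT T f : sqint (seg T) f -> continuous (sinT T f).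
Proof. by apply: continuous_transform; [exact: continuous_sin|exact: norm_sin_le1]. Qed.

Lemma continuous_energy T f : sqint (seg T) f -> continuous (energy T f).
Proof.
move=> hf w; have cc := continuous_cosT hf; have cs := continuous_sinT hf.
rewrite (_ : energy T f =
    (fun w => cosT T f w * cosT T f w + sinT T f w * sinT T f w)).
  exact: (cvgD (cvgM (cc w) (cc w)) (cvgM (cs w) (cs w))).
by apply/funext => x; rewrite /energy !expr2.
Qed.

Lemma transform_le (k : R -> R) T f w : continuous k ->
  (forall x, `|k x| <= 1) -> sqint (seg T) f ->
  `|\int[mu]_(t in seg T) (f t * k (w * t))| <= \int[mu]_(t in seg T) `|f t|.
Proof.
move=> ck k1 hf; have i := integrable_trig w ck k1 hf.
apply: le_trans (le_normr_Rintegral (measurable_seg T) i) _.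
apply: le_Rintegral; first exact: measurable_seg.
- exact: integrable_norm.
- exact: integrable_norm (integrable_sqint hf).
- by move=> t _; rewrite normrM ler_piMr.
Qed.

Lemma cos_transform T f w s : sqint (seg T) f ->
  \int[mu]_(t in seg T) (f t * cos (w * (s - t))) =
  cos (w * s) * cosT T f w + sin (w * s) * sinT T f w.
Proof.
move=> hf.
have ic := integrable_trig w (@continuous_cos R) norm_cos_le1 hf.
have is_ := integrable_trig w (@continuous_sin R) norm_sin_le1 hf.
have mI := measurable_seg T.
rewrite /cosT /sinT -!RintegralZl//.
rewrite -RintegralD//.
- by apply: eq_Rintegral => t _; rewrite mulrBr cosB; ring.
- exact: (integrableZl mI (cos (w * s)) ic).
- exact: (integrableZl mI (sin (w * s)) is_).
Qed.

(** Written as a single integral in s, against a kernel bounded in (w, s), the energy has the shape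
    that the exchange lemma accepts. *)
Lemma energyE T f w : sqint (seg T) f ->
  energy T f w = \int[mu]_(s in seg T)
    (f s * (cos (w * s) * cosT T f w + sin (w * s) * sinT T f w)).
Proof.
move=> hf.
have ic := integrable_trig w (@continuous_cos R) norm_cos_le1 hf.
have is_ := integrable_trig w (@continuous_sin R) norm_sin_le1 hf.
have mI := measurable_seg T.
transitivity (\int[mu]_(s in seg T) (f s * cos (w * s) * cosT T f w +
    f s * sin (w * s) * sinT T f w)); last first.
  by apply: eq_Rintegral => s _; ring.
rewrite RintegralD//.
- by rewrite !RintegralZr// /energy !expr2.
- exact: (integrableZr mI (cosT T f w) ic).
- exact: (integrableZr mI (sinT T f w) is_).
Qed.

(** Two successive exchanges of two integrals avoid a triple integral: the first moves the frequency
    inside the integral in s, the second inside the integral in t, where the damped cosine of w (s -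
    t) integrates to the kernel. *)
Lemma abel_energy T f e : 0 < e -> sqint (seg T) f ->
  \int[mu]_(w in `[0, +oo[) (expR (- e * w) * energy T f w) =
  \int[mu]_(s in seg T) (f s * \int[mu]_(t in seg T) (f t * poisson e (s - t))).
Proof.
move=> e0 hf; have [iE _] := laplace_expR e0.
have mI := measurable_seg T; have fi := integrable_sqint hf.
have mD : measurable (`[0, +oo[%classic : set mR) by exact: measurable_itv.
have cc := continuous_cosT hf; have cs := continuous_sinT hf.
have mm (k : R -> R) : continuous k -> measurable_fun [set: mR * mR] (fun z => k (z.1 * z.2)).
  move=> ck; apply: (measurableT_comp (continuous_measurable_fun ck)).
  by apply: measurable_funM; [exact: measurable_fst | exact: measurable_snd].
have m1 (k : R -> R) : continuous k -> measurable_fun [set: mR * mR] (fun z => k z.1).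
  move=> ck; apply: (measurableT_comp (continuous_measurable_fun ck)).
  exact: measurable_fst.
(* [C] bounds the cosine and the sine transform at every frequency, hence the kernel of the first
   exchange is at most [C + C]. *)
pose C := \int[mu]_(t in seg T) `|f t|.
have mk : measurable_fun [set: mR * mR]
    (fun z => cos (z.1 * z.2) * cosT T f z.1 + sin (z.1 * z.2) * sinT T f z.1).
  apply: measurable_funD; apply: measurable_funM.
  + exact: (mm _ (@continuous_cos R)).
  + exact: (m1 _ cc).
  + exact: (mm _ (@continuous_sin R)).
  + exact: (m1 _ cs).
have bk w s : `|cos (w * s) * cosT T f w + sin (w * s) * sinT T f w| <= C + C.
  rewrite (le_trans (ler_normD _ _))// !normrM; apply: lerD.
  + rewrite -[leRHS]mul1r; apply: ler_pM => //; first exact: norm_cos_le1.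
    apply: transform_le => //; [exact: continuous_cos|exact: norm_cos_le1].
  + rewrite -[leRHS]mul1r; apply: ler_pM => //; first exact: norm_sin_le1.
    apply: transform_le => //; [exact: continuous_sin|exact: norm_sin_le1].
have := (Rintegral_swap mD mI iE fi mk bk).2.
under eq_Rintegral do rewrite -energyE//.
move=> ->; apply: eq_Rintegral => s _; congr (_ * _).
under eq_Rintegral do rewrite -cos_transform//.
have mk' : measurable_fun [set: mR * mR] (fun z => cos (z.1 * (s - z.2))).
  apply: (measurableT_comp (continuous_measurable_fun (@continuous_cos R))).
  apply: measurable_funM; first exact: measurable_fst.
  by apply: measurable_funB => //; exact: measurable_snd.
have bk' w t : `|cos (w * (s - t))| <= 1 by exact: norm_cos_le1.
rewrite (Rintegral_swap mD mI iE fi mk' bk').2.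
by apply: eq_Rintegral => t _; rewrite Rintegral_expR_cos.
Qed.

End truncated_transform.

(** * Bessel's inequality *)

Section bessel.
Context {R : realType}.
Local Notation mu := (@lebesgue_measure R).
Local Notation mR := (measurableTypeR R).
Implicit Types (f g : R -> R) (I : set mR) (T e w s t : R).

Lemma mulr_le_half_sqr (a b : R) : a * b <= 2^-1 * (a ^+ 2 + b ^+ 2).
Proof. by rewrite -subr_ge0; have := sqr_ge0 (a - b); lra. Qed.

(** Serves as the half-line of nonnegative frequencies here and as the time axis later, where it is
    convertible with [Rplus]. *)
Definition half : set mR := `[0, +oo[.

Lemma measurable_half : measurable half.
Proof. exact: measurable_itv. Qed.

Definition smooth T e f s := \int[mu]_(t in seg T) (f t * poisson e (s - t)).

Lemma measurable_poisson2 e : 0 < e ->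
  measurable_fun [set: mR * mR] (fun z => poisson e (z.1 - z.2)).
Proof.
move=> e0; have cp := continuous_poisson e0.
apply: (measurableT_comp (continuous_measurable_fun cp)).
by apply: measurable_funB; [exact: measurable_fst | exact: measurable_snd].
Qed.

Lemma poisson_norm_le e x : 0 < e -> `|poisson e x| <= e^-1.
Proof. by move=> e0; rewrite ger0_norm ?poisson_ge0 ?poisson_le. Qed.

Lemma poissonC e s t : poisson e (s - t) = poisson e (t - s).
Proof. by rewrite /poisson -(opprB t s) sqrrN. Qed.

Lemma measurable_poisson1 e s I : 0 < e -> measurable_fun I (fun t => poisson e (s - t)).
Proof.
move=> e0; apply: measurable_funTS.
exact: (measurableT_comp (measurable_poisson2 e0) (measurable_pair1 s)).
Qed.

Lemma integrable_poisson T f e s : 0 < e -> mu.-integrable (seg T) (EFin \o f) ->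
  mu.-integrable (seg T) (EFin \o (fun t => f t * poisson e (s - t))).
Proof.
move=> e0 fi; apply: (@integrable_mul_bounded _ _ _ _ e^-1) => //.
- exact: measurable_seg.
- exact: measurable_poisson1.
- by move=> x _; exact: poisson_norm_le.
Qed.

Lemma integrable_smooth T e f g : 0 < e ->
  mu.-integrable (seg T) (EFin \o f) -> mu.-integrable (seg T) (EFin \o g) ->
  mu.-integrable (seg T) (EFin \o (fun s => g s * smooth T e f s)).
Proof.
move=> e0 fi gi; have mI := measurable_seg T.
exact: (Rintegral_swap mI mI gi fi (measurable_poisson2 e0)
  (fun x y => poisson_norm_le (x - y) e0)).1.
Qed.

Lemma smooth_cst1_le T e s : 0 <= T -> 0 < e -> smooth T e (cst 1) s <= pi.
Proof.
move=> T0 e0; rewrite /smooth; under eq_Rintegral do rewrite mul1r.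
exact: Rintegral_poisson_le.
Qed.

(** This is Schur's test: after the mean inequality the terms in f(s)^2 and in f(t)^2 contribute
    equally, because the kernel is symmetric. *)
Lemma smooth_le T e f : 0 <= T -> 0 < e -> sqint (seg T) f ->
  \int[mu]_(s in seg T) (f s * smooth T e f s) <=
  pi * \int[mu]_(s in seg T) (f s ^+ 2).
Proof.
move=> T0 e0 hf; have mI := measurable_seg T; have fi := integrable_sqint hf.
case: (hf) => mf f2i; have ci := integrable_seg_cst T 1.
have i1 := integrable_smooth e0 ci f2i.
have i2 := integrable_smooth e0 f2i ci.
have pf2 : mu.-integrable (seg T) (EFin \o (fun s => pi * f s ^+ 2)).
  exact: (integrableZl mI pi f2i).
(* The constant weight 1 in the variable s is written out so that the exchange lemma matches. *)
have E2 : \int[mu]_(s in seg T) (1 * smooth T e (fun t => f t ^+ 2) s) =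
          \int[mu]_(s in seg T) (f s ^+ 2 * smooth T e (cst 1) s).
  rewrite [LHS](Rintegral_swap mI mI ci f2i (measurable_poisson2 e0)
    (fun x y => poisson_norm_le (x - y) e0)).2.
  apply: eq_Rintegral => t _; congr (_ * _); apply: eq_Rintegral => s _.
  by rewrite poissonC.
have B1 : \int[mu]_(s in seg T) (f s ^+ 2 * smooth T e (cst 1) s) <=
          pi * \int[mu]_(s in seg T) (f s ^+ 2).
  rewrite -RintegralZl//; apply: le_Rintegral => //.
  by move=> s _; rewrite mulrC ler_wpM2r ?sqr_ge0 ?smooth_cst1_le.
have i12 : mu.-integrable (seg T) (EFin \o (fun s =>
    2^-1 * (f s ^+ 2 * smooth T e (cst 1) s + 1 * smooth T e (fun t => f t ^+ 2) s))).
  exact: (integrableZl mI 2^-1 (integrableD mI i1 i2)).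
apply: (@le_trans _ _ (\int[mu]_(s in seg T)
    (2^-1 * (f s ^+ 2 * smooth T e (cst 1) s +
             1 * smooth T e (fun t => f t ^+ 2) s)))).
  apply: (le_Rintegral mI (integrable_smooth e0 fi fi) i12).
  move=> s _; rewrite mul1r /smooth.
  have j0 := integrable_poisson s e0 fi.
  have j1 := integrable_poisson s e0 ci.
  have j2 := integrable_poisson s e0 f2i.
  have j1' := integrableZl mI (f s ^+ 2) j1.
  rewrite -(RintegralZl _ mI j0) -(RintegralZl _ mI j1) -(RintegralD mI j1' j2).
  rewrite -(RintegralZl _ mI (integrableD mI j1' j2)).
  apply: (le_Rintegral mI (integrableZl mI (f s) j0)
    (integrableZl mI 2^-1 (integrableD mI j1' j2))) => t _.
  have p0 := poisson_ge0 (s - t) e0.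
  rewrite mulrA (le_trans (ler_wpM2r p0 (mulr_le_half_sqr (f s) (f t))))//.
  by rewrite le_eqVlt; apply/orP; left; apply/eqP; rewrite /=; ring.
rewrite (RintegralZl _ mI (integrableD mI i1 i2)) (RintegralD mI i1 i2) E2.
by move: B1; move: (Rintegral _ _ _) (pi * _) => x y; lra.
Qed.

(** The Abel parameter runs through 1/(n + 1), because the convergence theorems are about
    sequences. *)
Definition damp (n : nat) w : R := expR (- harmonic n * w).

Lemma integrable_damp_energy T f n : sqint (seg T) f ->
  mu.-integrable half (EFin \o (fun w => damp n w * energy T f w)).
Proof.
move=> hf; have [iE _] := laplace_expR (harmonic_gt0 n : 0 < harmonic n :> R).
pose C := \int[mu]_(t in seg T) `|f t|.
apply: (@integrable_mul_bounded _ _ _ _ (C ^+ 2 + C ^+ 2)) => //.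
- exact: measurable_half.
- apply: measurable_funTS.
  exact: (continuous_measurable_fun (continuous_energy hf)).
- move=> w _; rewrite ger0_norm ?energy_ge0//; apply: lerD.
  + rewrite -(real_normK (num_real (cosT T f w))) lerXn2r ?nnegrE//.
      by apply: Rintegral_ge0.
    by apply: transform_le => //; [exact: continuous_cos|exact: norm_cos_le1].
  + rewrite -(real_normK (num_real (sinT T f w))) lerXn2r ?nnegrE//.
      by apply: Rintegral_ge0.
    by apply: transform_le => //; [exact: continuous_sin|exact: norm_sin_le1].
Qed.

Lemma damp_energyE T f n : sqint (seg T) f ->
  (\int[mu]_(w in half) (damp n w * energy T f w)%:E =
   (\int[mu]_(s in seg T) (f s * smooth T (harmonic n) f s))%:E)%E.
Proof.
move=> hf; rewrite /smooth -(abel_energy (harmonic_gt0 n) hf) /Rintegral fineK//.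
apply: integrable_fin_num; first exact: measurable_half.
exact: integrable_damp_energy.
Qed.

(** For w >= 0 the damping increases to 1 with n, so monotone convergence applies before the energy
    is known to be integrable. *)
Lemma cvg_damp_energy T f : sqint (seg T) f ->
  (\int[mu]_(w in half) (damp n w * energy T f w)%:E @[n --> \oo] -->
   \int[mu]_(w in half) (energy T f w)%:E)%E.
Proof.
move=> hf.
have cd w : damp n w @[n --> \oo] --> (1 : R).
  rewrite -[X in _ --> X]expR0; apply: continuous_cvg; first exact: continuous_expR.
  rewrite -[X in _ --> X](mul0r w); apply: cvgM; last exact: cvg_cst.
  by rewrite -oppr0; apply: cvgN; exact: cvg_harmonic.
rewrite (_ : (\int[mu]_(w in half) (energy T f w)%:E)%E =
  (\int[mu]_(w in half) limn (fun n => (damp n w * energy T f w)%:E))%E).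
  apply: cvg_monotone_convergence.
  - exact: measurable_half.
  - by move=> n; exact: measurable_int (integrable_damp_energy n hf).
  - by move=> n w _; rewrite lee_fin mulr_ge0 ?expR_ge0 ?energy_ge0.
  - move=> w; rewrite /half/= in_itv/= andbT => w0 m n mn.
    rewrite lee_fin ler_wpM2r ?energy_ge0// ler_expR !mulNr lerN2 ler_wpM2r//.
    by rewrite lef_pV2 ?posrE// ler_nat.
apply: eq_integral => w _; apply/esym/cvg_lim => //.
apply: cvg_EFin; first exact: nearW.
by rewrite -[X in _ --> X]mul1r; apply: cvgM; [exact: cd | exact: cvg_cst].
Qed.

(** Besides the bound, this yields integrability of the energy, on which the later real-valued
    computations rest. *)
Lemma bessel T f : 0 <= T -> sqint (seg T) f ->
  (\int[mu]_(w in half) (energy T f w)%:E <=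
   (pi * \int[mu]_(s in seg T) (f s ^+ 2))%:E)%E.
Proof.
move=> T0 hf; apply: (cvge_to_le (cvg_damp_energy hf)).
by apply: nearW => n; rewrite damp_energyE// lee_fin; exact: smooth_le (harmonic_gt0 n) hf.
Qed.

End bessel.

(** * Plancherel on [0, T] *)

Section plancherel_segment.
Context {R : realType}.
Local Notation mu := (@lebesgue_measure R).
Local Notation mR := (measurableTypeR R).
Implicit Types (f g : R -> R) (I : set mR) (T e w s t K : R).

Lemma Rintegral_seg_cst T (c : R) : 0 <= T ->
  \int[mu]_(t in seg T) cst c t = c * T.
Proof.
move=> T0; transitivity (c * fine (mu (seg T))).
  by apply: Rintegral_cst; exact: measurable_seg.
rewrite /seg lebesgue_measure_itv/= lte_fin; case: ltP => [_|T0'] /=.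
  by rewrite subr0.
by rewrite (le_anti (introT andP (conj T0' T0))) mulr0.
Qed.

(** The integral is split at |t - s| = d. Near s the oscillation of g is at most eta, against a mass
    at most pi; away from s the two values differ by at most 2 K, the kernel is at most e / d^2, and
    the length is at most T. *)
Lemma smooth_approx T e g K s d eta : 0 < e -> 0 <= T -> 0 < d -> 0 <= eta ->
  continuous g -> (forall t, `|g t| <= K) ->
  (forall t, `|t - s| < d -> `|g t - g s| <= eta) ->
  `|smooth T e g s - g s * smooth T e (cst 1) s| <=
    eta * pi + 2 * K * T * (e / d ^+ 2).
Proof.
move=> e0 T0 d0 eta0 cg gK gs.
have mI := measurable_seg T.
have mg : measurable_fun (seg T) g by apply: measurable_funTS; exact: continuous_measurable_fun.
have gi : mu.-integrable (seg T) (EFin \o g).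
  apply: measurable_bounded_integrable => //; first exact: seg_finite.
  by exists K; split; rewrite ?num_real// => x /ltW Kx t _; exact: le_trans Kx.
have ci := integrable_seg_cst T 1.
have j1 := integrable_poisson s e0 gi.
have j2 := integrable_poisson s e0 ci.
have j3 := integrableZl mI (g s) j2.
have ie : mu.-integrable (seg T) (EFin \o (fun t => eta * (1 * poisson e (s - t)))).
  exact: (integrableZl mI eta j2).
have ic := integrable_seg_cst T (2 * K * (e / d ^+ 2)).
rewrite /smooth -RintegralZl// -RintegralB//.
have jB := integrableB mI j1 j3.
apply: le_trans (le_normr_Rintegral mI jB) _.
apply: (@le_trans _ _ (\int[mu]_(t in seg T)
    (eta * (1 * poisson e (s - t)) + 2 * K * (e / d ^+ 2)))).
  apply: le_Rintegral => //.
  - exact: integrable_norm jB.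
  - exact: (integrableD mI ie ic).
  - move=> t _; have p0 := poisson_ge0 (s - t) e0.
    have K0 : 0 <= K by exact: le_trans (gK 0).
    rewrite !mul1r -mulrBl normrM (ger0_norm p0).
    have [td|dt] := ltP `|t - s| d.
      rewrite -[leLHS]addr0; apply: lerD; first by rewrite ler_wpM2r// gs.
      apply: mulr_ge0; first exact: mulr_ge0.
      by apply: divr_ge0; [exact: ltW | exact: exprn_ge0 (ltW d0)].
    rewrite -[leLHS]add0r; apply: lerD; first by rewrite mulr_ge0.
    apply: ler_pM => //.
      rewrite (le_trans (ler_normB _ _))// mulr_natl mulr2n; exact: lerD.
    by apply: poisson_tail => //; rewrite distrC.
rewrite (RintegralD mI ie ic) (RintegralZl eta mI j2).
rewrite (Rintegral_seg_cst (2 * K * (e / d ^+ 2)) T0) [leRHS](_ : _ =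
  eta * pi + 2 * K * (e / d ^+ 2) * T); last by ring.
by rewrite lerD2r ler_wpM2l//; exact: smooth_cst1_le.
Qed.

Lemma cvg_atan_harmonic x : 0 < x -> atan (x / harmonic n) @[n --> \oo] --> (pi / 2 : R).
Proof.
move=> x0; apply: (@cvg_comp _ _ _ (fun n => x / harmonic n) atan _ (pinfty_nbhs R));
  last exact: cvgy_atan.
apply/cvgryPge => A; near=> n; rewrite /harmonic/= invrK mulrC -ler_pdivrMr//.
rewrite (@le_trans _ _ n%:R) ?ler_nat//; near: n; exact: nbhs_infty_ger.
Unshelve. all: by end_near. Qed.

Lemma cvg_smooth T g K s : 0 < s < T -> continuous g -> (forall t, `|g t| <= K) ->
  smooth T (harmonic n) g s @[n --> \oo] --> pi * g s.
Proof.
move=> /andP[s0 sT] cg gK; have T0 : 0 <= T by rewrite ltW// (lt_trans s0).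
have K0 : 0 <= K by exact: le_trans (gK 0).
have c1 : g s * smooth T (harmonic n) (cst 1) s @[n --> \oo] --> pi * g s.
  rewrite mulrC; apply: cvgM; first exact: cvg_cst.
  rewrite (_ : (fun n => _) = (fun n => atan ((T - s) / harmonic n) + atan (s / harmonic n))).
    rewrite [X in _ --> X](splitr pi).
    by apply: cvgD; apply: cvg_atan_harmonic; rewrite ?subr_gt0.
  apply/funext => n; rewrite /smooth -Rintegral_poisson//; last exact: harmonic_gt0.
  by apply: eq_Rintegral => t _; rewrite mul1r.
suff c2 : smooth T (harmonic n) g s - g s * smooth T (harmonic n) (cst 1) s
    @[n --> \oo] --> 0.
  rewrite -[X in _ --> X]add0r (_ : (fun n => smooth T (harmonic n) g s) =
    (fun n => (smooth T (harmonic n) g s - g s * smooth T (harmonic n) (cst 1) s) +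
      g s * smooth T (harmonic n) (cst 1) s)).
    exact: cvgD c2 c1.
  by apply/funext => n; rewrite subrK.
apply/cvgr0Pnorm_le => eps eps0.
have pi1 : 0 < pi + 1 :> R by rewrite addr_gt0// pi_gt0.
(* Chosen so that eta pi for the near part plus eta for the far part is exactly eps. *)
pose eta := eps / (pi + 1).
have eta0 : 0 < eta by rewrite divr_gt0.
have [d d0 gd] : exists2 d : R, 0 < d & forall t, `|t - s| < d -> `|g t - g s| <= eta.
  have /cvgrPdist_le/(_ _ eta0)/nbhs_ballP[d /= d0 H] := cg s.
  exists d => // t td; rewrite distrC; apply: H.
  by rewrite /ball/= distrC.
have c3 : 2 * K * T * (harmonic n / d ^+ 2) @[n --> \oo] --> (0 : R).
  rewrite -[X in _ --> X](mulr0 (2 * K * T)); apply: cvgM; first exact: cvg_cst.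
  rewrite -[X in _ --> X](mul0r (d ^+ 2)^-1); apply: cvgM; last exact: cvg_cst.
  exact: cvg_harmonic.
move/cvgr0Pnorm_le : c3 => /(_ _ eta0); apply: filterS => n hn.
have := @smooth_approx T (harmonic n) g K s d eta (harmonic_gt0 n) T0 d0 (ltW eta0) cg gK gd.
move/le_trans; apply; rewrite [leRHS](_ : _ = eta * pi + eta).
  by rewrite lerD2l; exact: le_trans (ler_norm _) hn.
by rewrite -[X in _ + X]mulr1 -mulrDr /eta divfK// gt_eqF.
Qed.

Lemma cvg_smooth_energy T g K : 0 < T -> continuous g -> (forall t, `|g t| <= K) ->
  ((\int[mu]_(s in seg T) (g s * smooth T (harmonic n) g s))%:E @[n --> \oo] -->
  (pi * \int[mu]_(s in seg T) (g s ^+ 2))%:E)%E.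
Proof.
move=> T0 cg gK; have mI := measurable_seg T.
have K0 : 0 <= K by exact: le_trans (gK 0).
have mg : measurable_fun (seg T) g by apply: measurable_funTS; exact: continuous_measurable_fun.
have gi : mu.-integrable (seg T) (EFin \o g).
  apply: measurable_bounded_integrable => //; first exact: seg_finite.
  by exists K; split; rewrite ?num_real// => x /ltW Kx t _; exact: le_trans Kx.
have is_ n := integrable_smooth (harmonic_gt0 n) gi gi.
have mg2 : measurable_fun (seg T) (fun s => pi * g s ^+ 2).
  by apply: measurable_funM => //; exact: measurable_funX.
have gs_le n s : `|smooth T (harmonic n) g s| <= K * pi.
  have j1 := integrable_poisson s (harmonic_gt0 n) gi.
  have j2 := integrable_poisson s (harmonic_gt0 n) (integrable_seg_cst T 1).
  apply: le_trans (le_normr_Rintegral mI j1) _.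
  apply: (@le_trans _ _ (\int[mu]_(t in seg T) (K * (1 * poisson (harmonic n) (s - t))))).
    apply: le_Rintegral => //; first exact: integrable_norm j1.
      exact: (integrableZl mI K j2).
    move=> t _; have p0 := poisson_ge0 (s - t) (harmonic_gt0 n).
    by rewrite normrM mul1r (ger0_norm p0) ler_wpM2r.
  rewrite RintegralZl// ler_wpM2l//.
  by apply: smooth_cst1_le; [exact: ltW | exact: harmonic_gt0].
(* At the two endpoints the mass of the kernel tends to pi / 2 only, so the pointwise limit would be
   wrong there unless g vanishes; they form a null set. *)
have mN : measurable ([set 0; T] : set mR) by apply: measurableU; exact: measurable_set1.
have N0 : mu ([set 0; T] : set mR) = 0%E.
  apply: countable_lebesgue_measure0.
  by apply: finite_set_countable; rewrite finite_setU; split; exact: finite_set1.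
have mf n : measurable_fun (seg T) (fun s => (g s * smooth T (harmonic n) g s)%:E).
  exact: measurable_int (is_ n).
have mf' : measurable_fun (seg T) (fun s => (pi * g s ^+ 2)%:E) by exact/measurable_EFinP.
have ff : {ae mu, forall s, seg T s ->
    (g s * smooth T (harmonic n) g s)%:E @[n --> \oo] --> (pi * g s ^+ 2)%:E}.
  exists [set 0; T]; split => // s /= /not_implyP[]; rewrite /seg/= in_itv/= => /andP[s0 sT] H.
  have [->|s0'] := eqVneq s 0; first by left.
  have [->|sT'] := eqVneq s T; first by right.
  exfalso; apply: H.
  have s0T : 0 < s < T by rewrite !lt_neqAle s0 sT eq_sym s0' sT'.
  apply: cvg_EFin; first exact: nearW.
  rewrite expr2 mulrCA; apply: cvgM; first exact: cvg_cst.
  exact: (cvg_smooth s0T cg gK).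
have bnd : {ae mu, forall s n, seg T s ->
    (`|(g s * smooth T (harmonic n) g s)%:E| <= (K * (K * pi))%:E)%E}.
  by apply/aeW => s n _; rewrite abse_EFin lee_fin normrM ler_pM.
have [_ _] := dominated_convergence mI mf mf' ff (integrable_seg_cst T (K * (K * pi))) bnd.
have f2i : mu.-integrable (seg T) (EFin \o (fun s => g s ^+ 2)).
  apply: measurable_bounded_integrable => //; first exact: seg_finite.
    exact: measurable_funX.
  exists (K ^+ 2); split; rewrite ?num_real// => x /ltW Kx t _.
  by apply: le_trans Kx; rewrite normrX lerXn2r ?nnegrE.
have -> : (\int[mu]_(x in seg T) (pi * g x ^+ 2)%:E =
    (pi * \int[mu]_(s in seg T) (g s ^+ 2))%:E)%E.
  rewrite -RintegralZl// /Rintegral fineK//.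
  exact: (integrable_fin_num mI (integrableZl mI pi f2i)).
apply: cvg_trans; apply: near_eq_cvg; apply: nearW => n /=.
by rewrite /Rintegral fineK//; exact: (integrable_fin_num mI (is_ n)).
Qed.

(** Lets eta tend to 0 in estimates that hold only for eta <= 1. In the proof [c + 1] replaces [c]
    as a divisor because [c] may be 0. *)
Lemma ler_add_linear (x y c : R) : 0 <= c ->
  (forall eta, 0 < eta -> eta <= 1 -> x <= y + eta * c) -> x <= y.
Proof.
move=> c0 H; apply/ler_addgt0Pr => eps eps0.
have c1 : 0 < c + 1 by rewrite ltr_wpDl.
pose m := Num.min 1 (eps / (c + 1)).
have m0 : 0 < m by rewrite lt_min ltr01 divr_gt0.
apply: (le_trans (H m m0 _)); first by rewrite ge_min lexx.
rewrite lerD2l; apply: (@le_trans _ _ (eps / (c + 1) * (c + 1))).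
  by apply: ler_pM; rewrite ?(ltW m0) ?ge_min ?lexx ?orbT ?lerDl.
by rewrite divfK// gt_eqF.
Qed.

(** The two sides differ by the square (eta y - (x - y))^2 divided by eta. *)
Lemma cauchy_sqr_le (x y eta : R) : 0 < eta ->
  x ^+ 2 <= (1 + eta) * y ^+ 2 + (1 + eta^-1) * (x - y) ^+ 2.
Proof.
move=> e0; rewrite -subr_ge0.
have -> : (1 + eta) * y ^+ 2 + (1 + eta^-1) * (x - y) ^+ 2 - x ^+ 2 =
  eta^-1 * (eta * y - (x - y)) ^+ 2 by field; rewrite gt_eqF.
by rewrite mulr_ge0 ?sqr_ge0 ?invr_ge0 ?ltW.
Qed.

(** One sequence with two limits: the damped energies tend to the full energy by monotone
    convergence, and to pi times the squared norm by concentration of the kernel. *)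
Lemma bounded_continuous_energy T g K : 0 < T -> continuous g ->
  (forall t, `|g t| <= K) ->
  (\int[mu]_(w in half) (energy T g w)%:E =
   (pi * \int[mu]_(s in seg T) (g s ^+ 2))%:E)%E.
Proof.
move=> T0 cg gK.
have hg : sqint (seg T) g.
  have mg : measurable_fun (seg T) g by apply: measurable_funTS; exact: continuous_measurable_fun.
  split => //; apply: measurable_bounded_integrable; rewrite ?seg_finite//.
  - exact: measurable_seg.
  - exact: measurable_funX.
  exists (K ^+ 2); split; rewrite ?num_real// => x /ltW Kx t _.
  by apply: le_trans Kx; rewrite normrX lerXn2r ?nnegrE// (le_trans _ (gK 0)).
have := cvg_damp_energy hg.
rewrite (_ : (fun n => _) = (fun n =>
    (\int[mu]_(s in seg T) (g s * smooth T (harmonic n) g s))%:E)); last first.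
  by apply/funext => n; rewrite damp_energyE.
by move=> /cvg_unique; apply => //; exact: cvg_smooth_energy.
Qed.

(** Bounded values are wanted twice: by [cvg_smooth_energy], and in [continuous_dense] to compare
    squares with absolute values. *)
Definition clip K x : R := Num.max (- K) (Num.min K x).

Lemma clip_le K x : 0 <= K -> `|clip K x| <= K.
Proof.
move=> K0; rewrite ler_norml /clip le_max lexx/= ge_max.
by rewrite (le_trans _ K0) ?oppr_le0//= ge_min lexx.
Qed.

Lemma clip_id K x : `|x| <= K -> clip K x = x.
Proof. by rewrite ler_norml => /andP[Kx xK]; rewrite /clip (min_idPr xK) (max_idPr Kx). Qed.

Lemma clip_lipschitz K x y : `|clip K x - clip K y| <= `|x - y|.
Proof.
have h1 := ler_norm (x - y).
have h2 : y - x <= `|x - y| by rewrite distrC ler_norm.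
rewrite ler_norml; move: `|x - y| h1 h2 => d.
rewrite /clip !minEle !maxEle.
case: (leP K x) => ?; case: (leP K y) => ?; case: (leP (- K) K) => ?;
  case: (leP (- K) x) => ?; case: (leP (- K) y) => ?;
  move=> ? ?; apply/andP; split; lra.
Qed.

Lemma continuous_clip K g : continuous g -> continuous (fun t => clip K (g t)).
Proof.
move=> cg t; apply/cvgrPdist_le => eps eps0.
move/cvgrPdist_le : (cg t) => /(_ _ eps0); apply: filterS => x.
exact: le_trans (clip_lipschitz _ _ _).
Qed.

End plancherel_segment.

(** * Density of bounded continuous functions, and Plancherel on [0, T] in full *)

Section plancherel_segment_full.
Context {R : realType}.
Local Notation mu := (@lebesgue_measure R).
Local Notation mR := (measurableTypeR R).
Implicit Types (f g : R -> R) (I : set mR) (T e w s t K : R).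

Lemma measurable_clip K I f : measurable_fun I f ->
  measurable_fun I (fun t => clip K (f t)).
Proof.
have cK : continuous (clip K) by apply: (@continuous_clip _ K id) => ?; exact: cvg_id.
by move=> mf; exact: (measurableT_comp (continuous_measurable_fun cK) mf).
Qed.

Lemma sqint_bounded T f K : measurable_fun (seg T) f -> (forall t, `|f t| <= K) ->
  sqint (seg T) f.
Proof.
move=> mf fK; split => //; apply: measurable_bounded_integrable; rewrite ?seg_finite//.
- exact: measurable_seg.
- exact: measurable_funX.
exists (K ^+ 2); split; rewrite ?num_real// => x /ltW Kx t _.
by apply: le_trans Kx; rewrite normrX lerXn2r ?nnegrE// (le_trans _ (fK 0)).
Qed.

(** Dominated convergence with the bound 4 f^2, as clipping does not increase |x|; at each point the
    difference is exactly 0 from some n on. *)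
Lemma cvg_clip T f : sqint (seg T) f ->
  \int[mu]_(t in seg T) ((f t - clip n%:R (f t)) ^+ 2) @[n --> \oo] --> (0 : R).
Proof.
move=> hf; have mI := measurable_seg T.
have dom K x : 0 <= K -> (x - clip K x) ^+ 2 <= 4 * x ^+ 2.
  move=> K0; have := clip_lipschitz K x 0.
  rewrite (@clip_id _ K 0) ?normr0// !subr0 => h.
  have h2 : `|x - clip K x| <= 2 * `|x|.
    rewrite (le_trans (ler_normB _ _))//; move: h.
    by move: `|x| `|clip K x| => a b; lra.
  rewrite -(real_normK (num_real (x - _))) -(real_normK (num_real x)).
  rewrite (_ : 4 * `|x| ^+ 2 = (2 * `|x|) ^+ 2); last by ring.
  by rewrite lerXn2r ?nnegrE// mulr_ge0.
case: (hf) => mf f2i.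
have mh n : measurable_fun (seg T) (fun t => (f t - clip n%:R (f t)) ^+ 2).
  apply: measurable_funX; apply: measurable_funB => //; exact: measurable_clip.
have i4 : mu.-integrable (seg T) (EFin \o (fun t => 4 * f t ^+ 2)).
  exact: (integrableZl mI 4 f2i).
have ih n : mu.-integrable (seg T) (EFin \o (fun t => (f t - clip n%:R (f t)) ^+ 2)).
  apply: (le_integrable mI _ _ i4); first exact/measurable_EFinP.
  move=> t _ /=; rewrite lee_fin ger0_norm ?sqr_ge0//.
  by apply: le_trans (ler_norm _); exact: dom.
have mh' n := measurable_int _ (ih n).
have ff : {ae mu, forall t, seg T t ->
    ((f t - clip n%:R (f t)) ^+ 2)%:E @[n --> \oo] --> (cst 0%E : R -> \bar R) t}.
  apply/aeW => t _; apply: cvg_EFin; first exact: nearW.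
  apply: cvg_near_cst; near=> n.
  rewrite /= clip_id ?subrr ?expr0n//=; near: n; exact: nbhs_infty_ger.
have bnd : {ae mu, forall t n, seg T t ->
    (`|((f t - clip n%:R (f t)) ^+ 2)%:E| <= (4 * f t ^+ 2)%:E)%E}.
  apply/aeW => t n _; rewrite abse_EFin lee_fin ger0_norm ?sqr_ge0//.
  by apply: dom.
have [_ _] := dominated_convergence mI mh' (measurable_cst _) ff i4 bnd.
rewrite integral0 => /fine_cvgP[_]; exact.
Unshelve. all: by end_near. Qed.

(** The starting point is density in L_1. For u and v bounded by K, (u - v)^2 <= 2 K |u - v|, so
    closeness in L_1 gives closeness in L_2 once both f and the approximant are clipped at K. *)
Lemma continuous_dense T f (d : R) : sqint (seg T) f -> 0 < d ->
  exists g K, [/\ continuous g, forall t, `|g t| <= K &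
    \int[mu]_(t in seg T) ((f t - g t) ^+ 2) <= d].
Proof.
move=> hf d0; have mI := measurable_seg T.
have [n hn] : exists n : nat,
    \int[mu]_(t in seg T) ((f t - clip n%:R (f t)) ^+ 2) <= d / 4.
  have d4 : 0 < d / 4 by rewrite divr_gt0.
  move/cvgr0Pnorm_le : (cvg_clip hf) => /(_ _ d4)[n _ H].
  by exists n; exact: le_trans (ler_norm _) (H n (leqnn n)).
pose K : R := n%:R; pose fn t := clip K (f t).
have K0 : 0 <= K by exact: ler0n.
have fnK t : `|fn t| <= K by exact: clip_le.
have mfn : measurable_fun (seg T) fn by apply: measurable_clip; case: hf.
have hfn : sqint (seg T) fn by exact: (sqint_bounded mfn fnK).
have [g_ [cg ig]] := @approximation_continuous_integrable R (seg T) fn mI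
  (seg_finite T) (integrable_sqint hfn).
move=> /fine_cvgP[_ /cvgr0Pnorm_le].
(* After multiplication by 2 K this is at most d / 4, and K + 1 stays positive when K = 0. The
   clipping error takes another d / 4, and (x + y)^2 <= 2 (x^2 + y^2) doubles their sum to d. *)
have dK : 0 < d / (8 * (K + 1)) by rewrite divr_gt0// mulr_gt0// ltr_wpDl.
move=> /(_ _ dK)[k _ /(_ k (leqnn k))/= Hk].
pose g t := clip K (g_ k t).
have cgk : continuous g by apply: continuous_clip; exact: cg.
have gK t : `|g t| <= K by exact: clip_le.
have mg : measurable_fun (seg T) g by apply: measurable_funTS; exact: continuous_measurable_fun.
have hg : sqint (seg T) g by exact: (sqint_bounded mg gK).
exists g, K; split => //.
have h1 : sqint (seg T) (fun t => f t - fn t) by exact: sqintB.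
have h2 : sqint (seg T) (fun t => fn t - g t) by exact: sqintB.
have h3 : sqint (seg T) (fun t => f t - g t) by exact: sqintB.
have igk : mu.-integrable (seg T) (EFin \o (fun t => `|fn t - g_ k t|)).
  exact: (integrable_norm (integrableB mI (integrable_sqint hfn) (ig k))).
have B2 : \int[mu]_(t in seg T) ((fn t - g t) ^+ 2) <= d / 4.
  have igk' := integrableZl mI (2 * K) igk.
  apply: (@le_trans _ _ (\int[mu]_(t in seg T) (2 * K * `|fn t - g_ k t|))).
    apply: le_Rintegral => //; first by case: h2.
    move=> t _; rewrite -(real_normK (num_real (fn t - g t))) expr2.
    apply: ler_pM => //.
      rewrite (le_trans (ler_normB _ _))// mulr_natl mulr2n; exact: lerD.
    by rewrite -[X in `|X - _|](clip_id (fnK t)); exact: clip_lipschitz.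
  rewrite (RintegralZl _ mI igk).
  have Ig0 : 0 <= \int[mu]_(t in seg T) `|fn t - g_ k t| by apply: Rintegral_ge0.
  have Hk' : \int[mu]_(t in seg T) `|fn t - g_ k t| <= d / (8 * (K + 1)).
    exact: le_trans (ler_norm _) Hk.
  apply: (@le_trans _ _ (2 * K * (d / (8 * (K + 1))))).
    by rewrite ler_wpM2l// mulr_ge0.
  rewrite -subr_ge0 (_ : _ - _ = d / (4 * (K + 1))).
    by rewrite divr_ge0 ?(ltW d0)// mulr_ge0// addr_ge0.
  by field; rewrite gt_eqF// ltr_wpDl.
case: (h1) (h2) (h3) => _ i1 [_ i2] [_ i3].
have i12 : mu.-integrable (seg T) (EFin \o (fun t => 2 * ((f t - fn t) ^+ 2 + (fn t - g t) ^+ 2))).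
  exact: (integrableZl mI 2 (integrableD mI i1 i2)).
apply: (@le_trans _ _ (\int[mu]_(t in seg T) (2 * ((f t - fn t) ^+ 2 + (fn t - g t) ^+ 2)))).
  apply: le_Rintegral => // t _.
  rewrite -subr_ge0 (_ : _ - _ = (f t - fn t - (fn t - g t)) ^+ 2) ?sqr_ge0//.
  by ring.
rewrite (RintegralZl _ mI (integrableD mI i1 i2)) (RintegralD mI i1 i2).
move: hn B2; rewrite -/K -/fn.
by move: (\int[mu]_(t in seg T) _) (\int[mu]_(t in seg T) _) => a b; lra.
Qed.

Lemma cosTB T f g w : sqint (seg T) f -> sqint (seg T) g ->
  cosT T (fun t => f t - g t) w = cosT T f w - cosT T g w.
Proof.
move=> hf hg; have mI := measurable_seg T.
have i1 := integrable_trig w (@continuous_cos R) (@norm_cos_le1 R) hf.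
have i2 := integrable_trig w (@continuous_cos R) (@norm_cos_le1 R) hg.
rewrite /cosT -(RintegralB mI i1 i2).
by apply: eq_Rintegral => t _; rewrite mulrBl.
Qed.

Lemma sinTB T f g w : sqint (seg T) f -> sqint (seg T) g ->
  sinT T (fun t => f t - g t) w = sinT T f w - sinT T g w.
Proof.
move=> hf hg; have mI := measurable_seg T.
have i1 := integrable_trig w (@continuous_sin R) (@norm_sin_le1 R) hf.
have i2 := integrable_trig w (@continuous_sin R) (@norm_sin_le1 R) hg.
rewrite /sinT -(RintegralB mI i1 i2).
by apply: eq_Rintegral => t _; rewrite mulrBl.
Qed.

Lemma energy_cauchy T f g w (eta : R) : 0 < eta ->
  sqint (seg T) f -> sqint (seg T) g ->
  energy T g w <= (1 + eta) * energy T f w +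
                  (1 + eta^-1) * energy T (fun t => f t - g t) w.
Proof.
move=> e0 hf hg; rewrite {3}/energy cosTB// sinTB//.
have h1 := cauchy_sqr_le (cosT T g w) (cosT T f w) e0.
have h2 := cauchy_sqr_le (sinT T g w) (sinT T f w) e0.
rewrite (le_trans (lerD h1 h2))// /energy le_eqVlt; apply/orP; left.
by apply/eqP; ring.
Qed.

(** Bessel gives one inequality. For the other, f is compared with a bounded continuous g, for which
    equality is known, and Bessel applied to f - g bounds the energy of the error. *)
Lemma plancherel_half T f : 0 < T -> sqint (seg T) f ->
  (\int[mu]_(w in half) (energy T f w)%:E =
   (pi * \int[mu]_(s in seg T) (f s ^+ 2))%:E)%E.
Proof.
move=> T0 hf; have T0' := ltW T0; have mI := measurable_seg T.
apply/eqP; rewrite eq_le bessel//=.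
have iE g : sqint (seg T) g -> mu.-integrable half (EFin \o energy T g).
  move=> hg; apply/integrableP; split.
    apply/measurable_EFinP/measurable_funTS.
    exact: (continuous_measurable_fun (continuous_energy hg)).
  under eq_integral do rewrite /= ger0_norm ?energy_ge0//.
  by rewrite (le_lt_trans (bessel T0' hg))// ltry.
have mD : measurable (half : set mR) := measurable_half.
have EE g : sqint (seg T) g -> (\int[mu]_(w in half) (energy T g w)%:E =
    (\int[mu]_(w in half) energy T g w)%:E)%E.
  by move=> hg; rewrite /Rintegral fineK//; exact: (integrable_fin_num mD (iE g hg)).
rewrite (EE f hf) lee_fin.
set x := \int[mu]_(w in half) energy T f w.
have x0 : 0 <= x by apply: Rintegral_ge0 => w _; exact: energy_ge0.
have pi0 : 0 <= pi :> R by exact: pi_ge0.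
(* With squared distance eta^2 from f to g, the factor 1 + 1/eta leaves eta^2 + eta. The constants
   come from (1 + eta)^2 x <= x + 3 eta x and pi (eta^2 + eta) (2 + eta) <= 6 pi eta, valid for eta
   <= 1. *)
have key eta : 0 < eta -> eta <= 1 ->
    pi * \int[mu]_(s in seg T) (f s ^+ 2) <= x + eta * (3 * x + 6 * pi).
  move=> e0 e1; have e2 : 0 < eta ^+ 2 by rewrite exprn_gt0.
  have [g [K [cg gK dg]]] := continuous_dense hf e2.
  have mg : measurable_fun (seg T) g by apply: measurable_funTS; exact: continuous_measurable_fun.
  have hg : sqint (seg T) g by exact: (sqint_bounded mg gK).
  have hd : sqint (seg T) (fun t => f t - g t) by exact: sqintB.
  case: (hf) (hg) (hd) => _ if2 [_ ig2] [_ id2].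
  set d := \int[mu]_(t in seg T) _ in dg.
  have G := bounded_continuous_energy T0 cg gK.
  rewrite (EE g hg) in G; case: G => G.
  have z := bessel T0' hd; rewrite (EE _ hd) lee_fin -/d in z.
  set zz := \int[mu]_(w in half) _ in z.
  have I1 : \int[mu]_(s in seg T) (f s ^+ 2) <=
      (1 + eta) * \int[mu]_(s in seg T) (g s ^+ 2) + (1 + eta^-1) * d.
    rewrite -(RintegralZl _ mI ig2) -(RintegralZl _ mI id2).
    have j1 := integrableZl mI (1 + eta) ig2.
    have j2 := integrableZl mI (1 + eta^-1) id2.
    rewrite -(RintegralD mI j1 j2); apply: le_Rintegral => //.
      exact: (integrableD mI j1 j2).
    by move=> t _; exact: cauchy_sqr_le.
  have I2 : \int[mu]_(w in half) energy T g w <= (1 + eta) * x + (1 + eta^-1) * zz.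
    rewrite -(RintegralZl _ mD (iE f hf)) -(RintegralZl _ mD (iE _ hd)).
    have j1 := integrableZl mD (1 + eta) (iE f hf).
    have j2 := integrableZl mD (1 + eta^-1) (iE _ hd).
    rewrite -(RintegralD mD j1 j2); apply: le_Rintegral => //.
    - exact: iE.
    - exact: (integrableD mD j1 j2).
    - by move=> w _; exact: energy_cauchy.
  rewrite G in I2.
  have ei0 : 0 <= 1 + eta^-1 by rewrite addr_ge0// invr_ge0 ltW.
  have J1 := ler_wpM2l pi0 I1.
  have J2 : (1 + eta) * (pi * \int[mu]_(s in seg T) (g s ^+ 2)) <=
      (1 + eta) * ((1 + eta) * x + (1 + eta^-1) * (pi * eta ^+ 2)).
    rewrite ler_wpM2l ?addr_ge0 ?(ltW e0)//; apply: le_trans I2 _.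
    rewrite lerD2l ler_wpM2l//; apply: le_trans z _.
    by rewrite ler_wpM2l.
  have J3 : pi * ((1 + eta^-1) * d) <= pi * ((1 + eta^-1) * eta ^+ 2).
    by rewrite !ler_wpM2l.
  have E1 : (1 + eta^-1) * (pi * eta ^+ 2) = pi * (eta ^+ 2 + eta).
    by field; rewrite gt_eqF.
  have E2 : pi * ((1 + eta^-1) * eta ^+ 2) = pi * (eta ^+ 2 + eta).
    by field; rewrite gt_eqF.
  rewrite E1 in J2; rewrite E2 in J3.
  apply: le_trans J1 _; rewrite mulrDr.
  apply: (@le_trans _ _ ((1 + eta) * ((1 + eta) * x + pi * (eta ^+ 2 + eta)) +
    pi * (eta ^+ 2 + eta))).
    by apply: lerD => //; rewrite mulrCA.
  rewrite -subr_ge0.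
  have -> : x + eta * (3 * x + 6 * pi) - ((1 + eta) * ((1 + eta) * x +
      pi * (eta ^+ 2 + eta)) + pi * (eta ^+ 2 + eta)) =
    x * (eta * (1 - eta)) + pi * eta * ((1 - eta) * (eta + 4)) by ring.
  have e1' : 0 <= 1 - eta by rewrite subr_ge0.
  by rewrite addr_ge0// !mulr_ge0 ?(ltW e0)// addr_ge0 ?(ltW e0).
by apply: (@ler_add_linear _ _ _ (3 * x + 6 * pi)); rewrite ?addr_ge0 ?mulr_ge0.
Qed.

(** The energy is even in w because f is real, so the line counts twice the half-line. *)
Lemma plancherel_seg T f : 0 < T -> sqint (seg T) f ->
  (\int[mu]_w (energy T f w)%:E =
   (2 * pi * \int[mu]_(s in seg T) (f s ^+ 2))%:E)%E.
Proof.
move=> T0 hf; rewrite ge0_symfun_integralT; last 3 first.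
- by move=> w; exact: energy_ge0.
- exact: continuous_energy.
- move=> w; rewrite /= /energy /cosT /sinT; congr (_ ^+ 2 + _).
    by apply: eq_Rintegral => t _; rewrite mulNr cosN.
  under [X in _ = X ^+ 2]eq_Rintegral do rewrite mulNr sinN mulrN -mulN1r.
  rewrite RintegralZl ?mulN1r ?sqrrN//; first exact: measurable_seg.
  exact: integrable_trig w (@continuous_sin R) (@norm_sin_le1 R) hf.
by rewrite -set_itvcy plancherel_half// -EFinM mulrA.
Qed.

End plancherel_segment_full.

(** * The L_2 Fourier transform on the half-line *)

Section half_line.
Context {R : realType}.
Local Notation mu := (@lebesgue_measure R).
Local Notation mR := (measurableTypeR R).
Implicit Types (f g : R -> R) (T S w s t : R).

Lemma seg_sub_half T : seg T `<=` half.
Proof. by move=> t; rewrite /seg /half/= !in_itv/= andbT => /andP[]. Qed.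

Lemma sqint_half_seg T f : sqint half f -> sqint (seg T) f.
Proof.
apply: sqintS; [exact: measurable_half|exact: measurable_seg|exact: seg_sub_half].
Qed.

Definition mass f T := \int[mu]_(t in seg T) (f t ^+ 2).
Definition total f := \int[mu]_(t in half) (f t ^+ 2).

Lemma Rintegral_seg_restrict (f : R -> R) S T : 0 <= S -> S <= T ->
  mu.-integrable (seg T) (EFin \o f) ->
  \int[mu]_(t in seg T) ((f \_ `]S, +oo[) t) =
  \int[mu]_(t in seg T) f t - \int[mu]_(t in seg S) f t.
Proof.
move=> S0 ST fi; rewrite /seg Rintegral_itvB ?bnd_simp//.
rewrite -Rintegral_mkcondr; congr (Rintegral _ _ _).
apply/seteqP; split => t; rewrite /= !in_itv/= andbT.
  by move=> [/andP[_ ->] ->].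
by move=> /andP[St tT]; rewrite (le_trans S0 (ltW St)) tT.
Qed.

Lemma sqint_restrict f S T : sqint (seg T) f -> sqint (seg T) (f \_ `]S, +oo[).
Proof.
have mI := measurable_seg T; move=> [mf fi].
have mr : measurable_fun (seg T) (f \_ (`]S, +oo[ : set mR)).
  have mP : measurable (`]S, +oo[%classic : set mR) by exact: measurable_itv.
  apply: (measurable_restrict f mP mI).1.
  by apply: (measurable_funS mI _ mf) => ? [].
split => //; apply: (le_integrable mI _ _ fi).
  by apply/measurable_EFinP; exact: measurable_funX.
move=> t _ /=; rewrite lee_fin !ger0_norm ?sqr_ge0// patchE.
by case: ifP => // _; rewrite expr0n sqr_ge0.
Qed.

(** The difference of two truncated transforms is the transform of f restricted to ]S, T], to which
    Plancherel on [0, T] applies. Hence the truncated transforms are Cauchy in L_2 as soon as the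
    mass converges. *)
Lemma energy_diff f S T : 0 <= S -> S < T -> sqint (seg T) f ->
  (\int[mu]_w ((cosT T f w - cosT S f w) ^+ 2 +
               (sinT T f w - sinT S f w) ^+ 2)%:E =
   (2 * pi * (mass f T - mass f S))%:E)%E.
Proof.
move=> S0 ST hf; have T0 : 0 < T by exact: le_lt_trans ST.
pose h := f \_ (`]S, +oo[ : set R).
have hh : sqint (seg T) h by exact: sqint_restrict.
have hM (k : R -> R) t : h t * k t = ((fun t => f t * k t) \_ `]S, +oo[) t.
  by rewrite /h !patchE; case: ifP => //; rewrite mul0r.
have Ec w : cosT T h w = cosT T f w - cosT S f w.
  rewrite /cosT -Rintegral_seg_restrict ?(ltW ST)//.
    by apply: eq_Rintegral => t _; rewrite (hM (fun t => cos (w * t))).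
  exact: (integrable_trig w (@continuous_cos R) (@norm_cos_le1 R) hf).
have Es w : sinT T h w = sinT T f w - sinT S f w.
  rewrite /sinT -Rintegral_seg_restrict ?(ltW ST)//.
    by apply: eq_Rintegral => t _; rewrite (hM (fun t => sin (w * t))).
  exact: (integrable_trig w (@continuous_sin R) (@norm_sin_le1 R) hf).
have Em : \int[mu]_(t in seg T) (h t ^+ 2) = mass f T - mass f S.
  rewrite /mass -Rintegral_seg_restrict ?(ltW ST)//; last by case: hf.
  apply: eq_Rintegral => t _; rewrite /h !patchE; case: ifP => // _.
  by rewrite expr0n.
rewrite -Em -(plancherel_seg T0 hh).
by apply: eq_integral => w _; rewrite /energy Ec Es.
Qed.

(** Read off from [energy_diff]: 2 pi times the increment of the mass is the integral of a
    nonnegative function. *)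
Lemma mass_le f S T : 0 <= S -> S <= T -> sqint (seg T) f -> mass f S <= mass f T.
Proof.
move=> S0; rewrite le_eqVlt => /predU1P[->//|ST] hf.
have : (0 <= \int[mu]_w ((cosT T f w - cosT S f w) ^+ 2 +
               (sinT T f w - sinT S f w) ^+ 2)%:E)%E.
  by apply: integral_ge0 => w _; rewrite lee_fin addr_ge0 ?sqr_ge0.
rewrite energy_diff// lee_fin pmulr_rge0 ?subr_ge0// mulr_gt0//.
exact: pi_gt0.
Qed.

Lemma energy_dist f S T : 0 <= S -> 0 <= T -> sqint half f ->
  (\int[mu]_w ((cosT T f w - cosT S f w) ^+ 2 +
               (sinT T f w - sinT S f w) ^+ 2)%:E =
   (2 * pi * `|mass f T - mass f S|)%:E)%E.
Proof.
move=> S0 T0 hf; have hs A := sqint_half_seg A hf.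
have [ST|TS|->] := ltgtP S T.
- by rewrite energy_diff// ger0_norm// subr_ge0 mass_le// ltW.
- have -> : `|mass f T - mass f S| = mass f S - mass f T.
    by rewrite distrC ger0_norm// subr_ge0; apply: mass_le => //; exact: ltW.
  rewrite -(energy_diff T0 TS (hs S)); apply: eq_integral => w _; congr EFin.
  by rewrite -[in LHS]opprB sqrrN -[X in _ + X ^+ 2 = _]opprB sqrrN.
- rewrite subrr normr0 mulr0; apply: integral0_eq => w _.
  by rewrite !subrr expr0n addr0.
Qed.

Lemma mass_le_total f T : sqint half f -> mass f T <= total f.
Proof.
move=> hf; have hs := sqint_half_seg T hf.
case: hf hs => _ i1 [_ i2]; have mD : measurable (half : set mR) := measurable_half.
rewrite -lee_fin /mass /total /Rintegral !fineK.
- apply: ge0_subset_integral => //.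
  + exact: measurable_seg.
  + exact: measurable_int i1.
  + by move=> t _; rewrite lee_fin sqr_ge0.
  + exact: seg_sub_half.
- exact: (integrable_fin_num mD i1).
- exact: (integrable_fin_num (measurable_seg T) i2).
Qed.

Lemma cvg_mass f : sqint half f -> mass f n%:R @[n --> \oo] --> total f.
Proof.
move=> hf; have hs T := sqint_half_seg T hf.
have mD : measurable (half : set mR) := measurable_half.
have H : (\int[mu]_(t in seg n%:R) (f t ^+ 2)%:E @[n --> \oo] -->
          \int[mu]_(t in half) (f t ^+ 2)%:E)%E.
  rewrite (_ : half = \bigcup_n (seg n%:R : set mR)).
    apply: ge0_nondecreasing_set_cvg_integral.
    - move=> m n mn; apply/subsetPset => t; rewrite /seg/= !in_itv/= => /andP[-> /le_trans]; apply.
      by rewrite ler_nat.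
    - by move=> n; exact: measurable_seg.
    - by move=> n; case: (hs n%:R) => _ i; exact: measurable_int i.
    - by move=> n t _; rewrite lee_fin sqr_ge0.
  apply/seteqP; split => t.
    rewrite /half/= in_itv/= andbT => t0; exists (Num.truncn t).+1 => //.
    by rewrite /seg/= in_itv/= t0 ltW// Num.Theory.truncnS_gt.
  by move=> [n _]; exact: seg_sub_half.
apply: (@fine_cvg _ _ _ _ (fun n => (mass f n%:R)%:E)).
rewrite /total /Rintegral fineK; last by case: hf => _ i; exact: (integrable_fin_num mD i).
move: H; apply: cvg_trans; apply: near_eq_cvg; apply: nearW => n.
rewrite /mass /Rintegral fineK//; case: (hs n%:R) => _ i.
exact: (integrable_fin_num (measurable_seg _) i).
Qed.

(** Monotonicity in T carries the convergence from integers to all real horizons. *)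
Lemma near_mass f (d : R) : sqint half f -> 0 < d ->
  \forall T \near +oo, 0 <= T /\ `|total f - mass f T| <= d.
Proof.
move=> hf d0; have hs T := sqint_half_seg T hf.
move/cvgrPdist_le : (cvg_mass hf) => /(_ _ d0)[n _ /(_ n (leqnn n)) Hn].
near=> T.
have nT : n%:R <= T by near: T; exact: nbhs_pinfty_ge.
have T0 : 0 <= T by exact: le_trans nT.
split => //; rewrite ger0_norm ?subr_ge0 ?mass_le_total//.
apply: le_trans (le_trans (ler_norm _) Hn).
by rewrite lerD2l lerN2 mass_le.
Unshelve. all: by end_near. Qed.

(** Limit in mean of the truncated transforms of a scalar signal. The pair (a, b) stands for a - j
    b, so b is minus the imaginary part. *)
Definition sFT f (a b : R -> R) :=
  [/\ measurable_fun [set: mR] a, measurable_fun [set: mR] b &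
  ((\int[mu]_w ((a w - cosT T f w) ^+ 2 + (b w - sinT T f w) ^+ 2)%:E)%E
    @[T --> +oo] --> 0%E)].

End half_line.

(** * Riesz-Fischer argument: existence of the L_2 transform *)

Section riesz_fischer.
Context {R : realType}.
Local Notation mu := (@lebesgue_measure R).
Local Notation mR := (measurableTypeR R).
Implicit Types (f g : R -> R) (T S w s t : R).

Lemma cvg_sqr (u : nat -> R) (l : R) :
  u k @[k --> \oo] --> l -> u k ^+ 2 @[k --> \oo] --> l ^+ 2.
Proof.
by move=> h; rewrite expr2; under eq_fun do rewrite expr2; exact: cvgM.
Qed.

Lemma sum_half_pow_le n : \sum_(0 <= k < n) (2^-1 : R) ^+ k <= 2.
Proof.
suff -> : \sum_(0 <= k < n) (2^-1 : R) ^+ k = 2 - 2 * 2^-1 ^+ n.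
  by rewrite gerBl mulr_ge0 ?exprn_ge0.
elim: n => [|n IH]; first by rewrite big_geq// expr0 mulr1 subrr.
by rewrite big_nat_recr//= IH exprS; field.
Qed.

(* AM-GM turns a weighted square-summability bound into absolute summability:
   2 |x| <= 2^-k + 2^k x^2 *)
Lemma cvg_weighted_square (u e : nat -> R) (M : R) :
  (forall k, (u k.+1 - u k) ^+ 2 <= e k) ->
  (forall n, \sum_(0 <= k < n) 2 ^+ k * e k <= M) ->
  cvgn u.
Proof.
move=> ue eM.
have am k : `|u k.+1 - u k| <= 2^-1 ^+ k + 2 ^+ k * e k.
  have p0 : 0 < 2 ^+ k :> R by rewrite exprn_gt0.
  apply: (@le_trans _ _ (2^-1 ^+ k + 2 ^+ k * (u k.+1 - u k) ^+ 2)); last first.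
    by rewrite lerD2l ler_wpM2l// ltW.
  rewrite exprVn -(real_normK (num_real (u k.+1 - u k))).
  have := normr_ge0 (u k.+1 - u k); move: `|_| => x x0.
  rewrite -subr_ge0.
  have -> : (2 ^+ k)^-1 + 2 ^+ k * x ^+ 2 - x =
      2 ^+ k * ((x - (2 ^+ k)^-1) ^+ 2 + (2 ^+ k)^-1 * x).
    by field; rewrite gt_eqF.
  by rewrite mulr_ge0 ?(ltW p0)// addr_ge0 ?sqr_ge0// mulr_ge0// invr_ge0 ltW.
have cs : cvgn (series (telescope u)).
  apply: normed_cvg; apply: nondecreasing_is_cvgn.
    by apply: nondecreasing_series => k _ _; exact: normr_ge0.
  exists (2 + M) => _ [n _ <-] /=.
  apply: (@le_trans _ _ (\sum_(0 <= k < n) (2^-1 ^+ k + 2 ^+ k * e k))).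
    by apply: ler_sum => k _; exact: am.
  by rewrite big_split/= lerD ?sum_half_pow_le.
rewrite (_ : u = (fun n => u 0%N + series (telescope u) n)).
  by apply: is_cvgD => //; exact: is_cvg_cst.
by apply/funext => n; exact: eq_sum_telescope.
Qed.

Definition sqdist f S T w :=
  (cosT T f w - cosT S f w) ^+ 2 + (sinT T f w - sinT S f w) ^+ 2.

Lemma measurable_cosT T f : sqint (seg T) f -> measurable_fun [set: mR] (cosT T f).
Proof. by move=> hf; exact: continuous_measurable_fun (continuous_cosT hf). Qed.

Lemma measurable_sinT T f : sqint (seg T) f -> measurable_fun [set: mR] (sinT T f).
Proof. by move=> hf; exact: continuous_measurable_fun (continuous_sinT hf). Qed.

Lemma measurable_sqdist f S T : sqint half f -> measurable_fun [set: mR] (sqdist f S T).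
Proof.
move=> hf; have hs A := sqint_half_seg A hf.
have mc A := measurable_cosT (hs A); have ms A := measurable_sinT (hs A).
by apply: measurable_funD; apply: measurable_funX; apply: measurable_funB.
Qed.

(** The horizons [T_ k] leave a tail mass of at most 4^-k. Squared L_2 distances of consecutive
    transforms then decay like 4^-k and stay summable after multiplication by 2^k, so the weighted
    sum is finite almost everywhere, as [cvg_weighted_square] demands. *)
Lemma ae_cvg_transform f : sqint half f -> exists T_ : nat -> R,
  [/\ forall k, 0 <= T_ k, mass f (T_ k) @[k --> \oo] --> total f &
  {ae mu, forall w, cvgn (fun k => cosT (T_ k) f w) /\
                    cvgn (fun k => sinT (T_ k) f w)}].
Proof.
move=> hf; have hs T := sqint_half_seg T hf.
have q0 k : 0 < (2^-1 ^+ k) ^+ 2 :> R by rewrite !exprn_gt0.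
have /choice[T_ HT] : forall k, exists T, 0 <= T /\ `|total f - mass f T| <= (2^-1 ^+ k) ^+ 2.
  by move=> k; have /filter_ex[T HT] := near_mass hf (q0 k); exists T.
have T0 k : 0 <= T_ k by have [] := HT k.
exists T_; split => //.
  apply/cvgrPdist_le => d d0.
  have c0 : (2^-1 : R) ^+ k @[k --> \oo] --> (0 : R).
    by apply: cvg_expr; rewrite ger0_norm// invf_lt1// ltr1n.
  move/cvgr0Pnorm_le : c0 => /(_ (Num.min 1 d)).
  rewrite lt_min ltr01 d0 => /(_ isT); apply: filterS => k.
  rewrite ger0_norm ?exprn_ge0// le_min => /andP[k1 kd].
  apply: le_trans (HT k).2 _; apply: le_trans kd.
  by rewrite expr2 ler_piMr ?exprn_ge0.
pose e k w := 2 ^+ k * sqdist f (T_ k) (T_ k.+1) w.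
have e0 k w : 0 <= e k w by rewrite mulr_ge0 ?exprn_ge0// addr_ge0 ?sqr_ge0.
have me k : measurable_fun [set: mR] (EFin \o e k).
  apply/measurable_EFinP; apply: measurable_funM => //; exact: measurable_sqdist.
(* Two consecutive tails give at most twice 4^-k and Plancherel adds the factor 2 pi; with the
   weight 2^k this makes 4 pi 2^-k. *)
have Ie k : (\int[mu]_w (e k w)%:E <= (4 * pi * 2^-1 ^+ k)%:E)%E.
  have -> : (\int[mu]_w (e k w)%:E =
      (2 ^+ k)%:E * \int[mu]_w (sqdist f (T_ k) (T_ k.+1) w)%:E)%E.
    rewrite /e; under eq_integral do rewrite EFinM.
    apply: ge0_integralZl => //.
    - by apply/measurable_EFinP; exact: measurable_sqdist.
    - by move=> w _; rewrite lee_fin addr_ge0 ?sqr_ge0.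
  rewrite energy_dist// -EFinM lee_fin.
  have D : `|mass f (T_ k.+1) - mass f (T_ k)| <= 2 * (2^-1 ^+ k) ^+ 2.
    rewrite (_ : _ - _ = (total f - mass f (T_ k)) - (total f - mass f (T_ k.+1))); last by ring.
    rewrite (le_trans (ler_normB _ _))// mulr_natl mulr2n; apply: lerD; first by have [] := HT k.
    apply: le_trans (HT k.+1).2 _; rewrite lerXn2r ?nnegrE ?exprn_ge0//.
    by rewrite exprS ler_piMl ?exprn_ge0// invf_le1// ler1n.
  apply: (@le_trans _ _ (2 ^+ k * (2 * pi * (2 * (2^-1 ^+ k) ^+ 2)))).
    by rewrite ler_wpM2l ?exprn_ge0// ler_wpM2l// mulr_ge0// pi_ge0.
  rewrite le_eqVlt; apply/orP; left; apply/eqP; rewrite exprVn.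
  by field; rewrite expf_neq0.
pose h w := (\sum_(0 <= k <oo) (e k w)%:E)%E.
have mh : measurable_fun [set: mR] h.
  by apply: ge0_emeasurable_sum => [k w _ _|k _]; [rewrite lee_fin | exact: me].
have ih : mu.-integrable [set: mR] h.
  apply/integrableP; split => //.
  under eq_integral => w _.
    rewrite gee0_abs; last by apply: nneseries_ge0 => k _ _; rewrite lee_fin.
    over.
  rewrite integral_nneseries//; last by move=> k w _; rewrite lee_fin.
  apply: (@le_lt_trans _ _ (8 * pi)%:E); last exact: ltry.
  apply: lime_le.
    by apply: is_cvg_nneseries => k _ _; apply: integral_ge0 => w _; rewrite lee_fin.
  apply: nearW => n.
  apply: (@le_trans _ _ (\sum_(0 <= k < n) (4 * pi * 2^-1 ^+ k)%:E)%E).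
    by apply: lee_sum => k _; exact: Ie.
  rewrite sumEFin lee_fin -mulr_sumr.
  rewrite (_ : 8 * pi = 4 * pi * 2); last by ring.
  by rewrite ler_wpM2l ?sum_half_pow_le// mulr_ge0// pi_ge0.
have := integrable_ae measurableT ih.
apply: filterS => w /(_ Logic.I) hw.
have eM n : \sum_(0 <= k < n) 2 ^+ k * sqdist f (T_ k) (T_ k.+1) w <= fine (h w).
  rewrite -lee_fin fineK// -sumEFin.
  by apply: nneseries_lim_ge => k _ _; rewrite lee_fin; exact: e0.
split; apply: (cvg_weighted_square _ eM) => k.
  by rewrite /sqdist lerDl sqr_ge0.
by rewrite /sqdist lerDr sqr_ge0.
Qed.

Lemma sFT_exists f : sqint half f -> exists a b, sFT f a b.
Proof.
move=> hf; have hs T := sqint_half_seg T hf.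
have [T_ [T0 cT aecv]] := ae_cvg_transform hf.
(* The upper limit followed by [fine] is defined at every w and preserves measurability; it agrees
   with the limit wherever a finite one exists. *)
pose L (c : nat -> R -> R) w := fine (limn_esup (fun k => (c k w)%:E)).
have mL c : (forall k, measurable_fun [set: mR] (c k)) -> measurable_fun [set: mR] (L c).
  move=> mc; apply: (measurableT_comp (fine_measurable measurableT)).
  by apply: measurable_fun_limn_esup => k; exact/measurable_EFinP.
have cL (c : nat -> R -> R) w : cvgn (c^~ w) -> c k w @[k --> \oo] --> L c w.
  move=> /cvg_ex[l cl]; have cl' : (c k w)%:E @[k --> \oo] --> l%:E.
    by apply: cvg_EFin => //; exact: nearW.
  by rewrite /L (cvg_limn_einf_sup cl').2.
pose a := L (fun k => cosT (T_ k) f); pose b := L (fun k => sinT (T_ k) f).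
have ma : measurable_fun [set: mR] a by apply: mL => k; exact: measurable_cosT.
have mb : measurable_fun [set: mR] b by apply: mL => k; exact: measurable_sinT.
exists a, b; split => //.
pose D T w := (a w - cosT T f w) ^+ 2 + (b w - sinT T f w) ^+ 2.
have D0 T w : (0 <= (D T w)%:E)%E by rewrite lee_fin addr_ge0 ?sqr_ge0.
have mD T : measurable_fun [set: mR] (EFin \o D T).
  have := measurable_cosT (hs T); have := measurable_sinT (hs T) => ms mc.
  by apply/measurable_EFinP; apply: measurable_funD; apply: measurable_funX; apply: measurable_funB.
have msq T k : measurable_fun [set: mR] (fun w => (sqdist f T (T_ k) w)%:E).
  by apply/measurable_EFinP; exact: measurable_sqdist.
have sq0 T k w : (0 <= (sqdist f T (T_ k) w)%:E)%E by rewrite lee_fin addr_ge0 ?sqr_ge0.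
(* Fatou's lemma along k: the distance from the limit to the transform at horizon T is at most the
   lower limit of the distances between horizons T and [T_ k], which [energy_dist] gives exactly. *)
have B T : 0 <= T -> (\int[mu]_w (D T w)%:E <= (2 * pi * `|total f - mass f T|)%:E)%E.
  move=> TT0.
  apply: (@le_trans _ _ (\int[mu]_w limn_einf (fun k => (sqdist f T (T_ k) w)%:E))%E).
    apply: ae_ge0_le_integral => //.
    - exact: mD.
    - move=> w _; rewrite limn_einf_lim; apply: lime_ge; first exact: is_cvg_einfs.
      apply: nearW => n; apply: le_ereal_inf_tmp => _ [k _ <-]; exact: sq0.
    - rewrite (_ : (fun w => _) = (fun w =>
          - limn_esup (fun k => - (sqdist f T (T_ k) w)%:E))%E).
        apply: measurableT_comp => //; apply: measurable_fun_limn_esup => k.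
        by apply: measurableT_comp => //; exact: msq.
      by apply/funext => w; rewrite limn_esupN oppeK.
    - apply: (@filterS _ _ (ae_filter_ringOfSetsType mu) _ _ _ aecv) => w [ca0 cb0] _.
      have ca := cL (fun k => cosT (T_ k) f) w ca0.
      have cb := cL (fun k => sinT (T_ k) f) w cb0.
      have cc : (sqdist f T (T_ k) w)%:E @[k --> \oo] --> (D T w)%:E.
        apply: cvg_EFin; first exact: nearW.
        have c1 : cosT (T_ k) f w - cosT T f w @[k --> \oo] --> a w - cosT T f w.
          exact: (cvgB ca (cvg_cst _)).
        have c2 : sinT (T_ k) f w - sinT T f w @[k --> \oo] --> b w - sinT T f w.
          exact: (cvgB cb (cvg_cst _)).
        exact: (cvgD (cvg_sqr c1) (cvg_sqr c2)).
      by rewrite (cvg_limn_einf_sup cc).1.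
  apply: le_trans (fatou mu measurableT (msq T) (fun k w _ => sq0 T k w)) _.
  have cc : (\int[mu]_w (sqdist f T (T_ k) w)%:E)%E @[k --> \oo] -->
      (2 * pi * `|total f - mass f T|)%:E.
    rewrite (_ : (fun k => _) = (fun k => (2 * pi * `|mass f (T_ k) - mass f T|)%:E)).
      apply: cvg_EFin; first exact: nearW.
      apply: cvgM; first exact: cvg_cst.
      by apply: cvg_norm; apply: cvgB => //; exact: cvg_cst.
    by apply/funext => k; exact: energy_dist.
  by rewrite (cvg_limn_einf_sup cc).1.
apply: (@squeeze_cvge _ _ _ _ (cst 0%E) _ (fun T => (2 * pi * `|total f - mass f T|)%:E)).
- near=> T; have [TT0 _] : 0 <= T /\ `|total f - mass f T| <= 1.
    by near: T; exact: near_mass.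
  apply/andP; split; last exact: B.
  by apply: integral_ge0 => w _; exact: D0.
- exact: cvg_cst.
- apply: cvg_EFin; first exact: nearW.
  rewrite -[X in _ --> X](mulr0 (2 * pi)); apply: cvgM; first exact: cvg_cst.
  apply/cvgr0Pnorm_le => d d0; have := near_mass hf d0.
  by apply: filterS => T [_]; rewrite normr_id.
Unshelve. all: by end_near. Qed.

End riesz_fischer.

(** * Isometry, additivity and polarisation of the L_2 transform *)

Section plancherel.
Context {R : realType}.
Local Notation mu := (@lebesgue_measure R).
Local Notation mR := (measurableTypeR R).
Implicit Types (f g a b : R -> R) (T S w s t : R).

Lemma sFT_near f a b (d : R) : sqint half f -> sFT f a b -> 0 < d ->
  \forall T \near +oo, [/\ 0 <= T, `|total f - mass f T| <= d &
    (\int[mu]_w ((a w - cosT T f w) ^+ 2 + (b w - sinT T f w) ^+ 2)%:E <= d%:E)%E].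
Proof.
move=> hf [_ _ /fine_cvgP[Hfin Hc]] d0.
move/cvgr0Pnorm_le : Hc => /(_ _ d0) Hd.
have Hm := near_mass hf d0.
near=> T.
have [T0 mT] : 0 <= T /\ `|total f - mass f T| <= d by near: T.
split => //.
rewrite -[leLHS]fineK; last by near: T.
rewrite lee_fin; apply: le_trans (ler_norm _) _.
by near: T.
Unshelve. all: by end_near. Qed.

(** Stated in the extended reals, so that it applies before any of the integrals is known to be
    finite. *)
Lemma le_integral_sqr_sum (a b c d : R -> R) (eta : R) : 0 < eta ->
  measurable_fun [set: mR] a -> measurable_fun [set: mR] b ->
  measurable_fun [set: mR] c -> measurable_fun [set: mR] d ->
  (\int[mu]_w (a w ^+ 2 + b w ^+ 2)%:E <=
   (1 + eta)%:E * \int[mu]_w (c w ^+ 2 + d w ^+ 2)%:E +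
   (1 + eta^-1)%:E * \int[mu]_w ((a w - c w) ^+ 2 + (b w - d w) ^+ 2)%:E)%E.
Proof.
move=> e0 ma mb mc md.
have m2 (u v : R -> R) : measurable_fun [set: mR] u -> measurable_fun [set: mR] v ->
    measurable_fun [set: mR] (fun w => (u w ^+ 2 + v w ^+ 2)%:E).
  move=> mu' mv; apply/measurable_EFinP.
  by apply: measurable_funD; exact: measurable_funX.
have m1 := m2 _ _ mc md.
have m3 : measurable_fun [set: mR]
    (fun w => ((a w - c w) ^+ 2 + (b w - d w) ^+ 2)%:E).
  exact: (m2 _ _ (measurable_funB ma mc) (measurable_funB mb md)).
have e1 : 0 <= 1 + eta by rewrite addr_ge0// ltW.
have e2 : 0 <= 1 + eta^-1 by rewrite addr_ge0// invr_ge0 ltW.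
have p (u v : R) : (0 <= (u ^+ 2 + v ^+ 2)%:E)%E.
  by rewrite lee_fin addr_ge0 ?sqr_ge0.
rewrite -(ge0_integralZl_EFin mu measurableT (fun w _ => p _ _) m1 e1).
rewrite -(ge0_integralZl_EFin mu measurableT (fun w _ => p _ _) m3 e2).
rewrite -ge0_integralD//.
- apply: ge0_le_integral => //.
  + exact: m2.
  + by apply: emeasurable_funD; exact: measurable_funeM.
  + move=> w _; rewrite -!EFinM -EFinD lee_fin.
    rewrite (le_trans (lerD (cauchy_sqr_le (a w) (c w) e0) (cauchy_sqr_le (b w) (d w) e0)))//.
    by rewrite le_eqVlt; apply/orP; left; apply/eqP; ring.
- by move=> w _; rewrite mule_ge0// lee_fin.
- exact: measurable_funeM.
- by move=> w _; rewrite mule_ge0// lee_fin.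
- exact: measurable_funeM.
Qed.

(** Plancherel on [0, T] is compared with the limit in both directions. The upper estimate, taken at
    eta = 1, first shows that the integral is finite; only then can the lower estimate be written in
    real numbers. *)
Lemma sFT_plancherel f a b : sqint half f -> sFT f a b ->
  (\int[mu]_w (a w ^+ 2 + b w ^+ 2)%:E = (2 * pi * total f)%:E)%E.
Proof.
move=> hf hF; case: (hF) => ma mb _; have hs T := sqint_half_seg T hf.
have EE T : 0 <= T -> (\int[mu]_w (cosT T f w ^+ 2 + sinT T f w ^+ 2)%:E =
    (2 * pi * mass f T)%:E)%E.
  rewrite le_eqVlt => /predU1P[<-|T0]; last exact: plancherel_seg.
  rewrite /mass /cosT /sinT /seg set_itv1 !Rintegral_set1 mulr0.
  apply: integral0_eq => w _.
  by rewrite !Rintegral_set1 expr0n addr0.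
have cM T w : energy T f w = cosT T f w ^+ 2 + sinT T f w ^+ 2 by [].
have tot0 : 0 <= total f by apply: Rintegral_ge0 => t _; exact: sqr_ge0.
have pi0 : 0 <= pi :> R by exact: pi_ge0.
set X := (\int[mu]_w _)%E.
(* With A = [2 * pi * total f] and an error eta^2, the bound obtained is (1 + eta) A + eta^2 + eta,
   which is at most A + eta (A + 2) for eta <= 1. *)
have U eta : 0 < eta -> (X <= (2 * pi * total f + eta * (2 * pi * total f + 2))%:E)%E \/ 1 < eta.
  move=> e0; have [e1|] := leP eta 1; [left|by right].
  have e2 : 0 < eta ^+ 2 by rewrite exprn_gt0.
  have /filter_ex[T [T0 mT dT]] := sFT_near hf hF e2.
  have mc := measurable_cosT (hs T); have ms := measurable_sinT (hs T).
  apply: le_trans (le_integral_sqr_sum e0 ma mb mc ms) _.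
  rewrite EE//; apply: (@le_trans _ _ ((1 + eta)%:E * (2 * pi * total f)%:E +
      (1 + eta^-1)%:E * (eta ^+ 2)%:E)%E).
    apply: leeD; apply: lee_wpmul2l => //; rewrite lee_fin.
    - by rewrite addr_ge0// ltW.
    - by rewrite ler_wpM2l ?mulr_ge0// mass_le_total.
    - by rewrite addr_ge0// invr_ge0 ltW.
  rewrite -!EFinM -EFinD lee_fin -subr_ge0.
  have -> : 2 * pi * total f + eta * (2 * pi * total f + 2) -
    ((1 + eta) * (2 * pi * total f) + (1 + eta^-1) * eta ^+ 2) = eta * (1 - eta).
    by field; rewrite gt_eqF.
  by rewrite mulr_ge0 ?subr_ge0// ltW.
have X0 : (0 <= X)%E by apply: integral_ge0 => w _; rewrite lee_fin addr_ge0 ?sqr_ge0.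
have Xfin : X \is a fin_num.
  rewrite ge0_fin_numE//; case: (U 1 ltr01) => [H|]; last by rewrite ltxx.
  exact: le_lt_trans H (ltry _).
(* The additional 2 pi in the constant pays for replacing [total f] by [mass f T], which costs 2 pi
   eta^2. *)
have V eta : 0 < eta -> eta <= 1 ->
    2 * pi * total f <= fine X + eta * (2 * pi + fine X + 2).
  move=> e0 e1; have e2 : 0 < eta ^+ 2 by rewrite exprn_gt0.
  have /filter_ex[T [T0 mT dT]] := sFT_near hf hF e2.
  have mc := measurable_cosT (hs T); have ms := measurable_sinT (hs T).
  have := le_integral_sqr_sum e0 mc ms ma mb; rewrite EE// -/X.
  have -> : (\int[mu]_w ((cosT T f w - a w) ^+ 2 + (sinT T f w - b w) ^+ 2)%:E =
      \int[mu]_w ((a w - cosT T f w) ^+ 2 + (b w - sinT T f w) ^+ 2)%:E)%E.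
    apply: eq_integral => w _; congr EFin.
    by rewrite -(opprB (a w)) -(opprB (b w)) !sqrrN.
  move=> h; have {h}: ((2 * pi * mass f T)%:E <=
      ((1 + eta) * fine X + (1 + eta^-1) * eta ^+ 2)%:E)%E.
    apply: le_trans h _; rewrite [leRHS]EFinD [X in (_ <= X + _)%E]EFinM
      [X in (_ <= _ + X)%E]EFinM fineK//; apply: leeD => //.
    by apply: lee_wpmul2l => //; rewrite lee_fin addr_ge0// invr_ge0 ltW.
  rewrite lee_fin => h.
  have mT' : total f <= mass f T + eta ^+ 2.
    by rewrite -lerBlDl; exact: le_trans (ler_norm _) mT.
  have h2 : 2 * pi * total f <= 2 * pi * (mass f T + eta ^+ 2).
    by rewrite ler_wpM2l// mulr_ge0.
  apply: (le_trans h2); rewrite mulrDr.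
  apply: (le_trans (lerD h (lexx _))); rewrite -subr_ge0.
  have -> : fine X + eta * (2 * pi + fine X + 2) - ((1 + eta) * fine X +
      (1 + eta^-1) * eta ^+ 2 + 2 * pi * eta ^+ 2) =
      eta * (1 - eta) * (2 * pi + 1).
    by field; rewrite gt_eqF.
  apply: mulr_ge0; last by rewrite addr_ge0// mulr_ge0.
  by apply: mulr_ge0; [exact: ltW | rewrite subr_ge0].
rewrite -(fineK Xfin); congr EFin; apply/eqP; rewrite eq_le; apply/andP; split.
  apply: (@ler_add_linear _ _ _ (2 * pi * total f + 2)).
    by rewrite addr_ge0// !mulr_ge0.
  move=> eta e0 e1; rewrite -lee_fin fineK//.
  by case: (U _ e0) => //; rewrite ltNge e1.
apply: (@ler_add_linear _ _ _ (2 * pi + fine X + 2)).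
  by rewrite !addr_ge0 ?mulr_ge0 ?fine_ge0.
exact: V.
Qed.

(** The errors p and q of the two transforms combine by (p + q)^2 <= 2 (p^2 + q^2). Additivity feeds
    the polarisation below. *)
Lemma sFTD f g a b a' b' : sqint half f -> sqint half g ->
  sFT f a b -> sFT g a' b' ->
  sFT (fun t => f t + g t) (fun w => a w + a' w) (fun w => b w + b' w).
Proof.
move=> hf hg hF hG; case: (hF) (hG) => ma mb cF [ma' mb' cG].
have hs T := sqint_half_seg T hf; have hs' T := sqint_half_seg T hg.
split; [exact: measurable_funD|exact: measurable_funD|].
have Ec T w : cosT T (fun t => f t + g t) w = cosT T f w + cosT T g w.
  have i1 := integrable_trig w (@continuous_cos R) (@norm_cos_le1 R) (hs T).
  have i2 := integrable_trig w (@continuous_cos R) (@norm_cos_le1 R) (hs' T).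
  rewrite /cosT -(RintegralD (measurable_seg T) i1 i2).
  by apply: eq_Rintegral => t _; rewrite mulrDl.
have Es T w : sinT T (fun t => f t + g t) w = sinT T f w + sinT T g w.
  have i1 := integrable_trig w (@continuous_sin R) (@norm_sin_le1 R) (hs T).
  have i2 := integrable_trig w (@continuous_sin R) (@norm_sin_le1 R) (hs' T).
  rewrite /sinT -(RintegralD (measurable_seg T) i1 i2).
  by apply: eq_Rintegral => t _; rewrite mulrDl.
pose D (f a b : R -> R) T w := (a w - cosT T f w) ^+ 2 + (b w - sinT T f w) ^+ 2.
have D0 f1 a1 b1 T w : (0 <= (D f1 a1 b1 T w)%:E)%E.
  by rewrite lee_fin addr_ge0 ?sqr_ge0.
have mD f1 a1 b1 T : (forall T, sqint (seg T) f1) -> measurable_fun [set: mR] a1 ->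
    measurable_fun [set: mR] b1 -> measurable_fun [set: mR] (fun w => (D f1 a1 b1 T w)%:E).
  move=> h1 m1 m2; have mc := measurable_cosT (h1 T); have ms := measurable_sinT (h1 T).
  by apply/measurable_EFinP; apply: measurable_funD; apply: measurable_funX; apply: measurable_funB.
apply: (@squeeze_cvge _ _ _ _ (cst 0%E) _ (fun T =>
  (2%:E * (\int[mu]_w (D f a b T w)%:E + \int[mu]_w (D g a' b' T w)%:E))%E)).
- apply: nearW => T; apply/andP; split.
    by apply: integral_ge0 => w _; rewrite lee_fin addr_ge0 ?sqr_ge0.
  have m1 := mD f a b T hs ma mb; have m2 := mD g a' b' T hs' ma' mb'.
  rewrite -(ge0_integralD mu measurableT (fun w _ => D0 f a b T w) m1
    (fun w _ => D0 g a' b' T w) m2).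
  rewrite -ge0_integralZl//; last 2 first.
  + exact: emeasurable_funD.
  + by move=> w _; rewrite adde_ge0.
  apply: ge0_le_integral => //.
  + by move=> w _; rewrite lee_fin addr_ge0 ?sqr_ge0.
  + have mc := measurable_cosT (hs T); have ms := measurable_sinT (hs T).
    have mc' := measurable_cosT (hs' T); have ms' := measurable_sinT (hs' T).
    apply/measurable_EFinP; under eq_fun do rewrite Ec Es.
    by apply: measurable_funD; apply: measurable_funX; apply: measurable_funB; apply: measurable_funD.
  + by apply: measurable_funeM; exact: emeasurable_funD.
  + move=> w _; rewrite Ec Es -EFinD -EFinM lee_fin -subr_ge0 /D.
    have -> : 2 * ((a w - cosT T f w) ^+ 2 + (b w - sinT T f w) ^+ 2 +
        ((a' w - cosT T g w) ^+ 2 + (b' w - sinT T g w) ^+ 2)) -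
      ((a w + a' w - (cosT T f w + cosT T g w)) ^+ 2 +
       (b w + b' w - (sinT T f w + sinT T g w)) ^+ 2) =
      (a w - cosT T f w - (a' w - cosT T g w)) ^+ 2 +
      (b w - sinT T f w - (b' w - sinT T g w)) ^+ 2 by ring.
    by rewrite addr_ge0 ?sqr_ge0.
- exact: cvg_cst.
- rewrite -[X in _ --> X](mule0 2%:E); apply: cvgeZl => //.
  by have := cvgeD _ cF cG; rewrite adde0; exact.
Qed.

(** Plancherel for f, g and f + g, combined through u v = ((u + v)^2 - u^2 - v^2) / 2. *)
Lemma sFT_polar f g a b a' b' : sqint half f -> sqint half g ->
  sFT f a b -> sFT g a' b' ->
  mu.-integrable [set: mR] (EFin \o (fun w => a w * a' w + b w * b' w)) /\
  \int[mu]_w (a w * a' w + b w * b' w) = 2 * pi * \int[mu]_(t in half) (f t * g t).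
Proof.
move=> hf hg hF hG.
have mD : measurable (half : set mR) := measurable_half.
have hS := sFTD hf hg hF hG; have hfg := sqintD mD hf hg.
have int h c d : sqint half h -> sFT h c d ->
    mu.-integrable [set: mR] (EFin \o (fun w => c w ^+ 2 + d w ^+ 2)).
  move=> hh hH; apply/integrableP; split.
    case: hH => mc md _; apply/measurable_EFinP.
    by apply: measurable_funD; exact: measurable_funX.
  under eq_integral do rewrite /= ger0_norm ?addr_ge0 ?sqr_ge0//.
  by rewrite (sFT_plancherel hh hH) ltry.
have val h c d : sqint half h -> sFT h c d ->
    \int[mu]_w (c w ^+ 2 + d w ^+ 2) = 2 * pi * total h.
  by move=> hh hH; rewrite /Rintegral (sFT_plancherel hh hH).
have i1 := int _ _ _ hf hF; have i2 := int _ _ _ hg hG; have i3 := int _ _ _ hfg hS.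
have i12 := integrableD measurableT i1 i2.
have iB := integrableB measurableT i3 i12.
have E w : a w * a' w + b w * b' w = 2^-1 * ((a w + a' w) ^+ 2 + (b w + b' w) ^+ 2 -
    (a w ^+ 2 + b w ^+ 2 + (a' w ^+ 2 + b' w ^+ 2))) by field.
split.
  by apply: eq_integrable (integrableZl measurableT 2^-1 iB) => // w _ /=; rewrite E.
under eq_Rintegral do rewrite E.
rewrite (RintegralZl _ measurableT iB) (RintegralB measurableT i3 i12).
rewrite (RintegralD measurableT i1 i2) (val _ _ _ hf hF) (val _ _ _ hg hG) (val _ _ _ hfg hS).
have jfg := integrable_sqintM mD hf hg; case: (hf) (hg) => _ jf [_ jg].
have -> : total (fun t => f t + g t) = total f + total g + 2 * \int[mu]_(t in half) (f t * g t).
  rewrite /total -(RintegralZl _ mD jfg) -(RintegralD mD jf jg).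
  rewrite -(RintegralD mD (integrableD mD jf jg) (integrableZl mD 2 jfg)).
  by apply: eq_Rintegral => t _; ring.
by field.
Qed.

End plancherel.

(** * Vector signals and the quadratic constraint *)

Section vector_signals.
Context {R : realType}.
Local Notation mu := (@lebesgue_measure R).
Local Notation mR := (measurableTypeR R).
Local Notation C := (R[i]).

Lemma inL2_sqint p (z : sig R p) i : inL2 z -> sqint half (fun t => z t 0 i).
Proof.
move=> [mz iz]; have mD : measurable (half : set mR) := measurable_half.
have mz' j : measurable_fun (half : set mR) (fun t => z t 0 j) by exact: mz.
split => //; apply/integrableP; split.
  by apply/measurable_EFinP; exact: measurable_funX.
apply: le_lt_trans iz; apply: ge0_le_integral => //.
- apply: measurableT_comp => //; apply/measurable_EFinP; exact: measurable_funX.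
- apply/measurable_EFinP; apply: measurable_sum => j; exact: measurable_funX.
- move=> t _ /=; rewrite lee_fin ger0_norm ?sqr_ge0// /sqn (bigD1 i)//= lerDl.
  by rewrite sumr_ge0// => j _; exact: sqr_ge0.
Qed.

Lemma integrable_Rsum (A : set mR) I (r : seq I) (F : I -> R -> R) : measurable A ->
  (forall i, mu.-integrable A (EFin \o F i)) ->
  mu.-integrable A (EFin \o (fun t => \sum_(i <- r) F i t)).
Proof.
move=> mA iF.
have := integrable_sum mA r (P := xpredT) (fun i _ => iF i).
by apply: eq_integrable => // t _ /=; rewrite sumEFin.
Qed.

Lemma sqint_inL2 p (z : sig R p) : (forall i, sqint half (fun t => z t 0 i)) -> inL2 z.
Proof.
move=> hz; split=> [i|]; first by case: (hz i).
have mD : measurable (half : set mR) := measurable_half.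
apply: integrable_lty; first exact: mD.
by apply: integrable_Rsum => // i; case: (hz i).
Qed.

Lemma integrable_dotv p (u y : sig R p) : inL2 u -> inL2 y ->
  mu.-integrable half (EFin \o (fun t => dotv (u t) (y t))).
Proof.
move=> hu hy; have mD : measurable (half : set mR) := measurable_half.
apply: integrable_Rsum => // i.
by apply: integrable_sqintM => //; exact: inL2_sqint.
Qed.

Lemma sqn_dotv p (x : 'rV[R]_p) : sqn x = dotv x x.
Proof. by apply: eq_bigr => i _; rewrite expr2. Qed.

(** The minus sign appears because [ftT] carries the sine integral with a minus and [sFT] with a
    plus. Convergence holds because the error of one component is at most the total error. *)
Lemma isFT_sFT p (z : sig R p) Z i : inL2 z -> isFT z Z ->
  sFT (fun t => z t 0 i) (fun w => complex.Re (Z w 0 i))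
    (fun w => - complex.Im (Z w 0 i)).
Proof.
move=> hz [mZ cZ]; have hs T j := sqint_half_seg T (inL2_sqint j hz).
have mre j : measurable_fun [set: mR] (fun w => complex.Re (Z w 0 j)) by exact: (mZ j).1.
have mim j : measurable_fun [set: mR] (fun w => complex.Im (Z w 0 j)) by exact: (mZ j).2.
split => //; first exact: measurable_funN.
pose D j T w := (complex.Re (Z w 0 j) - cosT T (fun t => z t 0 j) w) ^+ 2 +
                (- complex.Im (Z w 0 j) - sinT T (fun t => z t 0 j) w) ^+ 2.
have D0 j T w : 0 <= D j T w by rewrite addr_ge0 ?sqr_ge0.
have mD j T : measurable_fun [set: mR] (D j T).
  have mc := measurable_cosT (hs T j); have ms := measurable_sinT (hs T j).
  apply: measurable_funD; apply: measurable_funX; apply: measurable_funB => //.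
  exact: measurable_funN.
have DE T w : sqnC (Z w - ftT T z w) = \sum_j D j T w.
  apply: eq_bigr => j _; rewrite !mxE /D; case: (Z w 0 j) => x y /=.
  by congr (_ + _); rewrite -/(sinT T (fun t => z t 0 j) w) -[RHS]sqrrN opprD !opprK.
apply: (@squeeze_cvge _ _ _ _ (cst 0%E) _ (fun T =>
  (\int[mu]_(w in setT) (sqnC (Z w - ftT T z w))%:E)%E)).
- apply: nearW => T; apply/andP; split.
    by apply: integral_ge0 => w _; rewrite lee_fin D0.
  under [leRHS]eq_integral do rewrite DE.
  apply: ge0_le_integral => //.
  + by move=> w _; rewrite lee_fin D0.
  + by apply/measurable_EFinP; exact: (mD i T).
  + by apply/measurable_EFinP; apply: measurable_sum => j; exact: mD.
  + move=> w _; rewrite lee_fin (bigD1 i)//= lerDl.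
    by rewrite sumr_ge0.
- exact: cvg_cst.
- exact: cZ.
Qed.

Lemma cvg_esum0 I (r : seq I) (X : I -> R -> \bar R) :
  (forall i, X i T @[T --> +oo] --> 0%E) ->
  (\sum_(i <- r) X i T)%E @[T --> +oo] --> 0%E.
Proof.
move=> cX; elim: r => [|i r IH].
  by under eq_fun do rewrite big_nil; exact: cvg_cst.
under eq_fun do rewrite big_cons.
by have := cvgeD _ (cX i) IH; rewrite adde0; exact.
Qed.

Lemma isFT_exists p (z : sig R p) : inL2 z -> exists Z, isFT z Z.
Proof.
move=> hz; have hs T j := sqint_half_seg T (inL2_sqint j hz).
have /choice[a Ha] : forall i, exists ab : (R -> R) * (R -> R),
    sFT (fun t => z t 0 i) ab.1 ab.2.
  by move=> i; have [a [b H]] := sFT_exists (inL2_sqint i hz); exists (a, b).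
exists (fun w => \row_i Complex ((a i).1 w) (- (a i).2 w)).
have ma i : measurable_fun [set: mR] (a i).1 by case: (Ha i).
have mb i : measurable_fun [set: mR] (a i).2 by case: (Ha i).
split.
  move=> i; split; under eq_fun do rewrite mxE /=; first exact: ma.
  exact: (measurable_funN (mb i)).
pose D j T w := ((a j).1 w - cosT T (fun t => z t 0 j) w) ^+ 2 +
                ((a j).2 w - sinT T (fun t => z t 0 j) w) ^+ 2.
have D0 j T w : 0 <= D j T w by rewrite addr_ge0 ?sqr_ge0.
have mD j T : measurable_fun [set: mR] (D j T).
  have mc := measurable_cosT (hs T j); have ms := measurable_sinT (hs T j).
  by apply: measurable_funD; apply: measurable_funX; apply: measurable_funB.
rewrite [X in X @ _ --> _](_ : _ =
    (fun T => \sum_(j <- index_enum 'I_p) \int[mu]_w (D j T w)%:E)%E).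
  by apply: cvg_esum0 => j; case: (Ha j).
apply/funext => T; rewrite -ge0_integral_sum//; last 2 first.
- by move=> j; apply/measurable_EFinP; exact: mD.
- by move=> j w _; rewrite lee_fin.
apply: eq_integral => w _; rewrite sumEFin; congr EFin.
apply: eq_bigr => j _; rewrite !mxE /D /=.
by congr (_ + _); rewrite -/(sinT T (fun t => z t 0 j) w) -[RHS]sqrrN opprB opprK addrC.
Qed.

Definition quad p (K : 'M[R]_p) (x : 'rV[R]_p) : R :=
  \sum_i \sum_j K i j * (x 0 i * x 0 j).

(** For real K this is the real part of x^* K x, since the real part of conj(a) b is Re a Re b + Im
    a Im b. *)
Definition herm p (K : 'M[R]_p) (x : 'rV[C]_p) : R :=
  \sum_i \sum_j K i j * (complex.Re (x 0 i) * complex.Re (x 0 j) +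
                         complex.Im (x 0 i) * complex.Im (x 0 j)).

(** A spectral density and a time density. The relation is stable under linear combinations, so
    Parseval for a quadratic form reduces to products of two components. *)
Definition parseval_pair (F G : R -> R) :=
  [/\ mu.-integrable [set: mR] (EFin \o F), mu.-integrable half (EFin \o G) &
   \int[mu]_w F w = 2 * pi * \int[mu]_(t in half) G t].

Lemma parseval_pairZ (c : R) F G : parseval_pair F G ->
  parseval_pair (fun w => c * F w) (fun t => c * G t).
Proof.
move=> [iF iG E]; have mD : measurable (half : set mR) := measurable_half.
split.
- exact: (integrableZl measurableT c iF).
- exact: (integrableZl mD c iG).
- by rewrite (RintegralZl _ measurableT iF) (RintegralZl _ mD iG) E mulrCA.
Qed.

Lemma parseval_pair_sum I (r : seq I) (F G : I -> R -> R) :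
  (forall i, parseval_pair (F i) (G i)) ->
  parseval_pair (fun w => \sum_(i <- r) F i w) (fun t => \sum_(i <- r) G i t).
Proof.
move=> H; have mD : measurable (half : set mR) := measurable_half.
have iF i : mu.-integrable [set: mR] (EFin \o F i) by case: (H i).
have iG i : mu.-integrable half (EFin \o G i) by case: (H i).
split; [exact: integrable_Rsum|exact: integrable_Rsum|].
elim: r => [|i r IH].
  under eq_Rintegral do rewrite big_nil.
  under [in RHS]eq_Rintegral do rewrite big_nil.
  by rewrite /Rintegral !integral0 mulr0.
under eq_Rintegral do rewrite big_cons.
under [in RHS]eq_Rintegral do rewrite big_cons.
rewrite (RintegralD measurableT (iF i) (integrable_Rsum r measurableT iF)).
rewrite (RintegralD mD (iG i) (integrable_Rsum r mD iG)) IH.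
by case: (H i) => _ _ ->; rewrite [RHS]mulrDr.
Qed.

Lemma parseval_quad p (K : 'M[R]_p) (z : sig R p) Z : inL2 z -> isFT z Z ->
  parseval_pair (fun w => herm K (Z w)) (fun t => quad K (z t)).
Proof.
move=> hz hZ; apply: parseval_pair_sum => i; apply: parseval_pair_sum => j.
apply: parseval_pairZ.
have hi := inL2_sqint i hz; have hj := inL2_sqint j hz.
have [I E] := sFT_polar hi hj (isFT_sFT i hz hZ) (isFT_sFT j hz hZ).
split.
(* The sine transforms are minus the imaginary parts; the two signs cancel in the product. *)
- by apply: eq_integrable I => // w _ /=; rewrite mulrNN.
- apply: integrable_sqintM => //; exact: measurable_half.
- by rewrite -E; apply: eq_Rintegral => w _; rewrite mulrNN.
Qed.

End vector_signals.

(** * From the matrix inequality at each frequency to an integral inequality in time *)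

Section frequency_inequality.
Context {R : realType}.
Local Notation mu := (@lebesgue_measure R).
Local Notation mR := (measurableTypeR R).
Local Notation C := (R[i]).

Lemma ReD (x y : C) : complex.Re (x + y) = complex.Re x + complex.Re y.
Proof. by case: x y => a b [c d]. Qed.

Lemma Re_sum I (r : seq I) (F : I -> C) :
  complex.Re (\sum_(i <- r) F i) = \sum_(i <- r) complex.Re (F i).
Proof. exact: (big_morph _ ReD). Qed.

Lemma Re_form p (K : 'M[R]_p) (v : 'cV[C]_p) :
  complex.Re ((ctr v *m map_mx (@toC R) K *m v) 0 0) = herm K v^T.
Proof.
rewrite mxE Re_sum /herm exchange_big/=; apply: eq_bigr => j _.
rewrite mxE mulr_suml Re_sum; apply: eq_bigr => i _.
rewrite !mxE; case: (v i 0) => a b; case: (v j 0) => c d.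
by rewrite /= /toC; simpc => /=; ring.
Qed.

Lemma quadE p (K : 'M[R]_p) (x : 'rV[R]_p) : (x *m K *m x^T) 0 0 = quad K x.
Proof.
rewrite mxE /quad exchange_big/=; apply: eq_bigr => j _.
rewrite mxE mulr_suml; apply: eq_bigr => i _.
by rewrite !mxE; ring.
Qed.

Lemma ctrM a b c (A : 'M[C]_(a, b)) (B : 'M[C]_(b, c)) :
  ctr (A *m B) = ctr B *m ctr A.
Proof. by rewrite /ctr map_mxM trmx_mul. Qed.

Lemma ctr_col_mx a b c (A : 'M[C]_(a, c)) (B : 'M[C]_(b, c)) :
  ctr (col_mx A B) = row_mx (ctr A) (ctr B).
Proof. by rewrite /ctr map_col_mx tr_col_mx. Qed.

Lemma toC_scale p (c : R) (K : 'M[R]_p) :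
  - (toC c) *: map_mx (@toC R) K = map_mx (@toC R) (- c *: K).
Proof. by apply/matrixP => i j; rewrite !mxE /toC; simpc. Qed.

Lemma herm_scale p (c : R) (K : 'M[R]_p) x : herm (c *: K) x = c * herm K x.
Proof.
rewrite /herm mulr_sumr; apply: eq_bigr => i _; rewrite mulr_sumr.
by apply: eq_bigr => j _; rewrite mxE mulrA.
Qed.

(** The matrix inequality is tested at v = x^T: [I; A] v stacks x^T and A x^T, and the block
    diagonal middle factor separates the two forms. *)
Lemma psd_herm n m (K : 'M[R]_(n + n)) (tau : R) (M : 'M[R]_m) (A : 'M[C]_(m, n + n))
  (x : 'rV[C]_(n + n)) :
  psdC (ctr (col_mx (1%:M : 'M[C]_(n + n)) A) *m
        block_mx (map_mx (@toC R) K) 0 0 (- (toC tau) *: map_mx (@toC R) M) *m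
        col_mx (1%:M : 'M[C]_(n + n)) A) ->
  tau * herm M (x *m A^T) <= herm K x.
Proof.
move=> /(_ x^T); rewrite !mulmxA -ctrM -!mulmxA mul_col_mx mul1mx mulmxA.
rewrite ctr_col_mx mul_row_block !mulmx0 addr0 add0r mul_row_col toC_scale.
(* Nonnegativity in C means imaginary part 0 and real part >= 0; the second half is kept. *)
rewrite lecE => /andP[_]; rewrite mxE ReD !Re_form trmxK herm_scale trmx_mul trmxK.
by rewrite /= mulNr subr_ge0.
Qed.

Lemma quad_kronI n (P : 'M[R]_2) (u y : 'rV[R]_n) : P^T = P ->
  quad (kronI n P) (row_mx u y) =
  P 0 0 * sqn u + 2 * P 0 1 * dotv u y + P 1 1 * sqn y.
Proof.
move=> PT; have P10 : P 1 0 = P 0 1 by rewrite -{1}PT mxE.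
rewrite -quadE /kronI mul_row_block tr_row_mx mul_row_col !mulmxDl !mul_mx_scalar.
rewrite -!scalemxAl !mxE P10 !sqn_dotv /dotv.
have E (a b : 'rV[R]_n) : \sum_j a 0 j * b^T j 0 = \sum_i a 0 i * b 0 i.
  by apply: eq_bigr => i _; rewrite mxE.
rewrite !E.
have -> : \sum_i y 0 i * u 0 i = \sum_i u 0 i * y 0 i.
  by apply: eq_bigr => i _; rewrite mulrC.
by ring.
Qed.

Lemma quad_integral_ge0 n m (M : 'M[R]_m)
  (N : sig R (n + n) -> sig R m) (Nhat : R -> 'M[C]_(m, n + n))
  (K : 'M[R]_(n + n)) (tau : R) (z : sig R (n + n)) :
  LTI_freq N Nhat -> inL2 z ->
  (0 <= \int[mu]_(t in @Rplus R) ((N z t *m M *m (N z t)^T) 0 0)%:E)%E ->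
  0 < tau ->
  (forall w : R,
     psdC (ctr (col_mx (1%:M : 'M[C]_(n + n)) (Nhat w)) *m
           block_mx (map_mx (@toC R) K) 0 0 (- (toC tau) *: map_mx (@toC R) M) *m
           col_mx (1%:M : 'M[C]_(n + n)) (Nhat w))) ->
  0 <= \int[mu]_(t in half) quad K (z t).
Proof.
move=> [NL2 [_ [_ [_ [_ Nfreq]]]]] hz iqc tau0 psd.
have [Z hZ] := isFT_exists hz.
(* The pointwise product is itself a transform of [N z], measurability included, so Parseval applies
   to it directly. *)
have hY := Nfreq z Z hz hZ.
have [iF _ EF] := parseval_quad K hz hZ.
have [iG _ EG] := parseval_quad M (NL2 z hz) hY.
have pi2 : 0 < 2 * pi :> R by rewrite mulr_gt0// pi_gt0.
have Q0 : 0 <= \int[mu]_(t in half) quad M (N z t).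
  apply: fine_ge0; move: iqc; congr (_ <= _)%E.
  by apply: eq_integral => t _; rewrite quadE.
(* The comparison takes place in frequency, where each integral is 2 pi times its time
   counterpart. *)
rewrite -(pmulr_rge0 _ pi2) -EF.
apply: (@le_trans _ _ (tau * \int[mu]_w herm M (Z w *m (Nhat w)^T))).
  by rewrite EG; apply: mulr_ge0; [exact: ltW | apply: mulr_ge0 => //; exact: ltW].
rewrite -(RintegralZl _ measurableT iG); apply: le_Rintegral => //.
  exact: (integrableZl measurableT tau iG).
by move=> w _; exact: psd_herm.
Qed.

End frequency_inequality.

(** * Points of the scaled graph and the region S(Pi) *)

Section scaled_graph.
Context {R : realType}.
Local Notation mu := (@lebesgue_measure R).
Local Notation mR := (measurableTypeR R).
Local Notation C := (R[i]).

Lemma inL2_sub p (u v : sig R p) : inL2 u -> inL2 v -> inL2 (sig_sub u v).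
Proof.
move=> hu hv; apply: sqint_inL2 => i.
have := sqintB measurable_half (inL2_sqint i hu) (inL2_sqint i hv).
by apply: eq_sqint => [|t _]; [exact: measurable_half | rewrite !mxE].
Qed.

Lemma inL2_stack n (u y : sig R n) : inL2 u -> inL2 y -> inL2 (stack u y).
Proof.
move=> hu hy; apply: sqint_inL2 => i; rewrite /stack.
have mD : measurable (half : set mR) := measurable_half.
case: (split_ordP i) => j ->.
  by apply: (eq_sqint mD _ (inL2_sqint j hu)) => t _; rewrite row_mxEl.
by apply: (eq_sqint mD _ (inL2_sqint j hy)) => t _; rewrite row_mxEr.
Qed.

Lemma nrm_sqr p (u : sig R p) :
  nrm u ^+ 2 = \int[mu]_(t in half) dotv (u t) (u t).
Proof.
rewrite sqr_sqrtr.
  by apply: eq_Rintegral => t _; rewrite sqn_dotv.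
by apply: Rintegral_ge0 => t _; apply: sumr_ge0 => i _; exact: sqr_ge0.
Qed.

(** Cauchy-Schwarz by the discriminant: the squared norm of x u + y is nonnegative at its minimiser
    x = - <u, y> / |u|^2. *)
Lemma ip_sqr_le p (u y : sig R p) : inL2 u -> inL2 y -> nrm u != 0 ->
  ip u y ^+ 2 <= nrm u ^+ 2 * nrm y ^+ 2.
Proof.
move=> hu hy u0; have mD : measurable (half : set mR) := measurable_half.
have A0 : 0 < nrm u ^+ 2 by rewrite exprn_even_gt0.
have iu := integrable_dotv hu hu; have iy := integrable_dotv hy hy.
have iuy := integrable_dotv hu hy.
have H x : 0 <= x ^+ 2 * nrm u ^+ 2 + 2 * x * ip u y + nrm y ^+ 2.
  rewrite !nrm_sqr /ip.
  rewrite -(RintegralZl _ mD iu) -(RintegralZl _ mD iuy).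
  have j1 := integrableZl mD (x ^+ 2) iu; have j2 := integrableZl mD (2 * x) iuy.
  rewrite -(RintegralD mD j1 j2) -(RintegralD mD (integrableD mD j1 j2) iy).
  apply: Rintegral_ge0 => t _; rewrite /dotv !mulr_sumr -!big_split/=.
  apply: sumr_ge0 => i _.
  rewrite (_ : _ + _ = (x * u t 0 i + y t 0 i) ^+ 2) ?sqr_ge0//.
  by ring.
have := H (- ip u y / nrm u ^+ 2).
have -> : (- ip u y / nrm u ^+ 2) ^+ 2 * nrm u ^+ 2 +
    2 * (- ip u y / nrm u ^+ 2) * ip u y + nrm y ^+ 2 =
    (nrm u ^+ 2 * nrm y ^+ 2 - ip u y ^+ 2) / nrm u ^+ 2.
  by field.
by rewrite pmulr_lge0 ?invr_gt0// subr_ge0.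
Qed.

(** Cauchy-Schwarz enters twice: it puts the argument of [acos] in [-1, 1], and when |y| = 0, where
    the gain vanishes, it forces <u, y> = 0. *)
Lemma gain_cos_phase p (u y : sig R p) : inL2 u -> inL2 y -> nrm u != 0 ->
  gain u y * cos (phase u y) = ip u y / nrm u ^+ 2.
Proof.
move=> hu hy u0; have cs := ip_sqr_le hu hy u0; rewrite /gain /phase u0/=.
have [y0|y0] := eqVneq (nrm y) 0.
  rewrite y0 !mul0r; move: cs; rewrite y0 expr0n/= mulr0.
  have := sqr_ge0 (ip u y) => h1 h2.
  have /eqP : ip u y ^+ 2 = 0 by apply/eqP; rewrite eq_le h1 h2.
  by rewrite sqrf_eq0 => /eqP ->; rewrite mul0r.
rewrite acosK; last first.
  have d0 : 0 < nrm u * nrm y by rewrite mulr_gt0 // lt_neqAle eq_sym ?u0 ?y0 sqrtr_ge0.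
  rewrite in_itv/= -ler_norml normrM normfV (gtr0_norm d0) ler_pdivrMr// mul1r.
  rewrite -(@ler_pXn2r _ 2) ?nnegrE ?(ltW d0)// real_normK ?num_real// exprMn.
  exact: cs.
by field; rewrite u0 y0.
Qed.

(** For symmetric P the two cross terms are conjugate, so the form is real and takes the value P00 +
    2 P01 Re z + P11 |z|^2. *)
Lemma SPiE (P : 'M[R]_2) a b : P^T = P ->
  0 <= P 0 0 + 2 * P 0 1 * a + P 1 1 * (a ^+ 2 + b ^+ 2) ->
  SPi P (Complex a b).
Proof.
move=> PT h; have P10 : P 1 0 = P 0 1 by rewrite -{1}PT mxE.
rewrite /SPi/= !mxE !big_ord_recl big_ord0 !mxE !big_ord_recl !big_ord0 !mxE /=.
have -> : lift ord0 ord0 = 1 :> 'I_2 by exact/val_inj.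
rewrite -[ord0]/(0 : 'I_2) P10 mulr1 !addr0 /toC; simpc.
apply/andP; split; first by apply/eqP; ring.
by apply: le_trans h _; rewrite le_eqVlt; apply/orP; left; apply/eqP; ring.
Qed.

(** The form depends on b through b^2 alone, so fixing b^2 covers both conjugate points at once.
    Division by |u|^2 > 0 carries the integral inequality to the point z. *)
Lemma graph_point_SPi p (P : 'M[R]_2) (u y : sig R p) b : P^T = P ->
  inL2 u -> inL2 y -> nrm u != 0 ->
  0 <= \int[mu]_(t in half) quad (kronI p P) (row_mx (u t) (y t)) ->
  b ^+ 2 = (gain u y * sin (phase u y)) ^+ 2 ->
  SPi P (Complex (gain u y * cos (phase u y)) b).
Proof.
move=> PT hu hy u0 Q b2; have mD : measurable (half : set mR) := measurable_half.
have A0 : 0 < nrm u ^+ 2 by rewrite exprn_even_gt0.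
apply: SPiE => //.
have E2 (g c : R) : (g * cos c) ^+ 2 + (g * sin c) ^+ 2 = g ^+ 2.
  by rewrite !exprMn -mulrDr cos2Dsin2 mulr1.
rewrite b2 E2 gain_cos_phase//.
have iu := integrable_dotv hu hu; have iy := integrable_dotv hy hy.
have iuy := integrable_dotv hu hy.
have j1 := integrableZl mD (P 0 0) iu.
have j2 := integrableZl mD (2 * P 0 1) iuy.
have j3 := integrableZl mD (P 1 1) iy.
have E : \int[mu]_(t in half) quad (kronI p P) (row_mx (u t) (y t)) =
    P 0 0 * nrm u ^+ 2 + 2 * P 0 1 * ip u y + P 1 1 * nrm y ^+ 2.
  rewrite !nrm_sqr /ip.
  rewrite -(RintegralZl _ mD iu) -(RintegralZl _ mD iuy) -(RintegralZl _ mD iy).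
  rewrite -(RintegralD mD j1 j2) -(RintegralD mD (integrableD mD j1 j2) j3).
  by apply: eq_Rintegral => t _; rewrite quad_kronI// !sqn_dotv.
move: Q; rewrite E => Q.
have -> : P 0 0 + 2 * P 0 1 * (ip u y / nrm u ^+ 2) + P 1 1 * gain u y ^+ 2 =
    (P 0 0 * nrm u ^+ 2 + 2 * P 0 1 * ip u y + P 1 1 * nrm y ^+ 2) / nrm u ^+ 2.
  by rewrite /gain; field.
by rewrite divr_ge0// ltW.
Qed.

End scaled_graph.

Theorem theorem1 (R : realType) (n m : nat) (H : sig R n -> sig R n)
  (M : 'M[R]_m) (N : sig R (n + n) -> sig R m) (Nhat : R -> 'M[R[i]]_(m, n + n)) :
  is_system H -> causal_on (@inL2e R n) H -> bounded H ->
  M^T = M -> LTI_freq N Nhat ->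
  soft_iqc H M N ->
  forall (Pi : 'M[R]_2) (tau : R), Pi^T = Pi -> 0 < tau ->
  (forall w : R,
     psdC (ctr (col_mx (1%:M : 'M[R[i]]_(n + n)) (Nhat w)) *m
           block_mx (map_mx (@toC R) (kronI n Pi)) 0 0 (- (toC tau) *: map_mx (@toC R) M) *m
           col_mx (1%:M : 'M[R[i]]_(n + n)) (Nhat w))) ->
  SRG H `<=` SPi Pi.
Proof.
move=> _ _ _ _ hN iqc Pi tau PiT tau0 psd z [u1 [u2 [h1 k1 h2 k2 /= [u0 hz]]]].
have hu := inL2_sub h1 h2; have hy := inL2_sub k1 k2.
have Q := quad_integral_ge0 hN (inL2_stack hu hy) (iqc _ _ h1 k1 h2 k2) tau0 psd.
by case: hz => ->; apply: graph_point_SPi => //; rewrite sqrrN.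
Qed.
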